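(* Let $n\in\{2,3\}$, let $\Omega\subset\mathbb{R}^n$ be a Lipschitz domain with boundary $\Gamma=\partial\Omega$, let $T>0$, $I=(0,T)$, $\Sigma=I\times\Gamma$. Let $f\in H^{1/2,1/4}(\Sigma)$, and let $\phi\in H^{-1/2,-1/4}(\Sigma)$ be the solution of $\mathscr{V}\phi=f$, where $\mathscr{V}$ is the single-layer operator of the heat equation. Let $\mathcal{P}$ be a prismatic mesh of $\Sigma$ with some associated discrete (finite-dimensional) trial space $\mathcal{X}\subset H^{-1/2,-1/4}(\Sigma)$. Let the estimators $\eta_{\mathcal P}(\Phi)$, $\zeta_{\mathcal P}(\Phi)$, the local indicators $\eta_{\mathcal P}(\Phi,J\times K)$, $\zeta_{\mathcal P}(\Phi,J\times K)$, and the constants $C_{\rm nei},C_{\rm shape},C_{\rm cont},c_{\rm coe},C_{\rm eff}',C_{\rm rel}'$ be as defined in the context. Then: (a) There exist constants $C_{\rm eff},\tilde C_{\rm rel}>0$ such that for arbitrary $\Phi\in\mathcal{X}$, $$ C_{\rm eff}^{-1}\,\eta_{\mathcal P}(\Phi)\le\|\phi-\Phi\|_{H^{-1/2,-1/4}(\Sigma)}\le\tilde C_{\rm rel}\,\big(\eta_{\mathcal P}(\Phi)^2+\zeta_{\mathcal P}(\Phi)^2\big)^{1/2}. $$ (b) If $\mathcal{X}$ contains all $\mathcal{P}$-piecewise constant functions and $\Phi\in\mathcal{X}$ is the Galerkin approximation of $\phi$ in $\mathcal{X}$, i.e. $\langle\mathscr{V}\Phi,\Psi\rangle_\Sigma=\langle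 f,\Psi\rangle_\Sigma$ for all $\Psi\in\mathcal{X}$, then for all $J\times K\in\mathcal{P}$, $$ \zeta_{\mathcal P}(\Phi,J\times K)^2\le C_{\rm shape}\big(\operatorname{diam}(K)^{-1}+|J|^{-1/2}\big)\big(\operatorname{diam}(K)+|J|^{1/2}\big)\,\eta_{\mathcal P}(\Phi,J\times K)^2 . $$ (c) If, in the situation of (b), additionally $C_{\rm grad}^{-1}\operatorname{diam}(K)\le|J|^{1/2}\le C_{\rm grad}\operatorname{diam}(K)$ for all $J\times K\in\mathcal{P}$ with a uniform constant $C_{\rm grad}\ge1$, then there exists a constant $C_{\rm rel}>0$ such that $$ \|\phi-\Phi\|_{H^{-1/2,-1/4}(\Sigma)}\le C_{\rm rel}\,\eta_{\mathcal P}(\Phi). $$ The constants are given as $C_{\rm eff}=C_{\rm eff}'\,C_{\rm cont}$, $\tilde C_{\rm rel}=C_{\rm rel}'/c_{\rm coe}$, and $C_{\rm rel}=\tilde C_{\rm rel}\sqrt{2C_{\rm shape}(1+C_{\rm grad})}$.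
   Context: Notation: $|\cdot|$ denotes absolute value, Euclidean norm, or the measure of a set (length of an interval, $(n-1)$-dimensional surface measure on $\Gamma$); $\overline I=[0,T]$. Anisotropic Sobolev spaces. For an $(n-1)$-dimensional $\omega\subseteq\Gamma$ and $\mu\in(0,1)$, set $|w|_{H^\mu(\omega)}^2:=\int_\omega\int_\omega\frac{|w(x)-w(y)|^2}{|x-y|^{n-1+2\mu}}\,dy\,dx$, $\|w\|_{H^\mu(\omega)}^2:=\|w\|_{L_2(\omega)}^2+|w|_{H^\mu(\omega)}^2$, and let $H^\mu(\omega)$ be the space of $w\in L_2(\omega)$ with finite norm. For a subinterval $J\subseteq\overline I$, $\nu\in(0,1)$, and a Banach space $X$, set $|v|_{H^\nu(J;X)}^2:=\int_J\int_J\frac{\|v(t)-v(s)\|_X^2}{|t-s|^{1+2\nu}}\,ds\,dt$, $\|v\|_{H^\nu(J;X)}^2:=\|v\|_{L_2(J;X)}^2+|v|_{H^\nu(J;X)}^2$, and let $H^\nu(J;X)$ be the space of $v\in L_2(J;X)$ with finite norm. Define $H^{\mu,\nu}(J\times\omega):=L_2(J;H^\mu(\omega))\cap H^\nu(J;L_2(\omega))$ with norm $\|v\|_{H^{\mu,\nu}(J\times\omega)}^2:=\|v\|_{L_2(J;H^\mu(\omega))}^2+\|v\|_{H^\nu(J;L_2(\omega))}^2$; in particular $H^{\mu,\nu}(\Sigma)=H^{\mu,\nu}(I\times\Gamma)$. Abbreviate $|v|_{L_2(J;H^\mu(\omega))}^2:=\int_J|v(t,\cdot)|_{H^\mu(\omega)}^2\,dt$.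 $H^{-1/2,-1/4}(\Sigma)$ is the dual space of $H^{1/2,1/4}(\Sigma)$, with duality pairing $\langle v,\psi\rangle_\Sigma$ ($v\in H^{1/2,1/4}(\Sigma)$, $\psi\in H^{-1/2,-1/4}(\Sigma)$); $L_2(\Sigma)$ is regarded as a subspace of $H^{-1/2,-1/4}(\Sigma)$ via $\langle v,\psi\rangle_\Sigma=\int_I\int_\Gamma v\psi\,dx\,dt$. Single-layer operator. With the heat kernel $G(t,x)=(4\pi t)^{-n/2}e^{-|x|^2/(4t)}$ for $t>0$, $x\in\mathbb{R}^n$, and $G(t,x)=0$ otherwise, $\mathscr{V}$ is given by $(\mathscr{V}\psi)(t,x)=\int_\Sigma G(t-s,x-y)\,\psi(s,y)\,dy\,ds$ for $(t,x)\in\Sigma$. It is a known fact (taken as given) that $\mathscr{V}$ is a bounded linear isomorphism $H^{-1/2,-1/4}(\Sigma)\to H^{1/2,1/4}(\Sigma)$, whose operator norm is denoted $C_{\rm cont}$, and that it is coercive: there is $c_{\rm coe}>0$ with $\langle\mathscr{V}\psi,\psi\rangle_\Sigma\ge c_{\rm coe}\|\psi\|_{H^{-1/2,-1/4}(\Sigma)}^2$ for all $\psi\in H^{-1/2,-1/4}(\Sigma)$. Prismatic mesh. A prismatic mesh $\mathcal{P}$ of $\Sigma$ is a finite set of prisms $P=J\times K$, where $J\subseteq\overline I$ is a non-empty compact interval and $K\subseteq\Gamma$ is the image of a compact Lipschitz domain $\hat K\subset\mathbb{R}^{n-1}$ (the closure of a bounded Lipschitz domain; for $n=2$, a compact interval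 with non-empty interior) under a bi-Lipschitz mapping, such that distinct $P,\tilde P\in\mathcal{P}$ intersect in a set of measure zero on $\Sigma$, and $\mathcal{P}$ is a partition of $\Sigma$, i.e. $\Sigma=\bigcup_{P\in\mathcal{P}}P$ (up to the endpoints of the time interval). For $t\in\overline I$ and $x\in\Gamma$, put $\mathcal{P}|_t:=\{K\subseteq\Gamma:(\{t\}\times\Gamma)\cap(J\times K)\ne\emptyset\text{ for some }J\times K\in\mathcal{P}\}$ and $\mathcal{P}|_x:=\{J\subseteq\overline I:(\overline I\times\{x\})\cap(J\times K)\neq\emptyset\text{ for some }J\times K\in\mathcal{P}\}$. Mesh constants. $C_{\rm nei},C_{\rm dist},C_{\rm shape},C_{\rm lqu}\ge1$ are constants (which exist for each fixed prismatic mesh) such that: for almost all $t\in\overline I$, $\#\{\tilde K\in\mathcal{P}|_t:K\cap\tilde K\ne\emptyset\}\le C_{\rm nei}$ for all $K\in\mathcal{P}|_t$; for almost all $t$, $\operatorname{diam}(K)\le C_{\rm dist}\operatorname{dist}(K,\tilde K)$ for all $K,\tilde K\in\mathcal{P}|_t$ with $K\cap\tilde K=\emptyset$; for almost all $t$, $C_{\rm shape}^{-1}|K|\le\operatorname{diam}(K)^{n-1}\le C_{\rm shape}|K|$ for all $K\in\mathcal{P}|_t$; for almost all $x\in\Gamma$, $|J|\le C_{\rm lqu}|\tilde J|$ for all $J,\tilde J\in\mathcal{P}|_x$ with $J\cap\tilde J\neq\emptyset$. Indicators and estimators. For $\Phi\in\mathcal{X}$ and $J\times K\in\mathcal{P}$,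 let $\eta_{\mathcal P}^{x}(\Phi,J\times K)^2:=\sum|f-\mathscr{V}\Phi|^2_{L_2(J\cap\tilde J;H^{1/2}(K\cup\tilde K))}$, the sum running over all $\tilde J\times\tilde K\in\mathcal{P}$ with $|J\cap\tilde J|>0$ and $K\cap\tilde K\ne\emptyset$; $\eta_{\mathcal P}^{t}(\Phi,J\times K)^2:=\sum|f-\mathscr{V}\Phi|^2_{H^{1/4}(J\cup\tilde J;L_2(K\cap\tilde K))}$, the sum running over all $\tilde J\times\tilde K\in\mathcal{P}$ with $J\cap\tilde J\ne\emptyset$ and $|K\cap\tilde K|>0$; $\zeta_{\mathcal P}^{x}(\Phi,J\times K)^2:=\operatorname{diam}(K)^{-1}\|f-\mathscr{V}\Phi\|_{L_2(J\times K)}^2$; $\zeta_{\mathcal P}^{t}(\Phi,J\times K)^2:=|J|^{-1/2}\|f-\mathscr{V}\Phi\|_{L_2(J\times K)}^2$. Set $\eta_{\mathcal P}(\Phi,J\times K)^2:=\eta_{\mathcal P}^{x}(\Phi,J\times K)^2+\eta_{\mathcal P}^{t}(\Phi,J\times K)^2$, $\zeta_{\mathcal P}(\Phi,J\times K)^2:=\zeta_{\mathcal P}^{x}(\Phi,J\times K)^2+\zeta_{\mathcal P}^{t}(\Phi,J\times K)^2$, $\eta_{\mathcal P}(\Phi)^2:=\sum_{J\times K\in\mathcal{P}}\eta_{\mathcal P}(\Phi,J\times K)^2$, and $\zeta_{\mathcal P}(\Phi)^2:=\sum_{J\times K\in\mathcal{P}}\zeta_{\mathcal P}(\Phi,J\times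 K)^2$. Constants $C_{\rm eff}'$ and $C_{\rm rel}'$. $C_{\rm eff}':=\max(2(C_{\rm nei}+1)^2,32)$. $C_{\rm rel}'>0$ is a constant, depending only on $n$, $\Gamma$, $|I|$, $C_{\rm dist}$, $C_{\rm lqu}$, such that for all $v\in H^{1/2,1/4}(\Sigma)$, $(C_{\rm rel}')^{-2}\|v\|_{H^{1/2,1/4}(\Sigma)}^2$ is bounded from above by $$\sum_{J\times K\in\mathcal{P}}\Bigg(\sum_{\substack{\tilde J\times\tilde K\in\mathcal{P}\\ |J\cap\tilde J|>0\\ K\cap\tilde K\neq\emptyset}}|v|_{L_2(J\cap\tilde J;H^{1/2}(K\cup\tilde K))}^2+\sum_{\substack{\tilde J\times\tilde K\in\mathcal{P}\\ J\cap\tilde J\neq\emptyset\\ |K\cap\tilde K|>0}}|v|_{H^{1/4}(J\cup\tilde J;L_2(K\cap\tilde K))}^2\Bigg)+\sum_{J\times K\in\mathcal{P}}\big(\operatorname{diam}(K)^{-1}+|J|^{-1/2}\big)\|v\|_{L_2(J\times K)}^2 ;$$ the existence of such a constant is part of the paper's preceding localization theorem. *)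

(* Defs.v *)
From HB Require Import structures.
From mathcomp Require Import all_boot all_order all_algebra finmap.
From mathcomp Require Import all_classical all_reals all_analysis.

Set Implicit Arguments.
Unset Strict Implicit.
Unset Printing Implicit Defensive.

Import Order.TTheory GRing.Theory Num.Theory.
Import numFieldNormedType.Exports.

Local Open Scope classical_set_scope.
Local Open Scope ring_scope.

(* The library's norm on row vectors is the sup norm; the Euclidean norm and
   inner product are introduced separately.  The topology is the same. *)
Definition dotp (R : realType) (n : nat) (x y : 'rV[R]_n) : R :=
  \sum_(i < n) x 0 i * y 0 i.

Definition enorm (R : realType) (n : nat) (x : 'rV[R]_n) : R :=
  Num.sqrt (dotp x x).

Definition eudist (R : realType) (n : nat) (x y : 'rV[R]_n) : R :=
  enorm (x - y).

(* [sup set0 = 0], so the diameter of the empty set is 0; only meant for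
   bounded sets. *)
Definition diam (R : realType) (n : nat) (A : set 'rV[R]_n) : R :=
  sup [set eudist x y | x in A & y in A].

Definition set_dist (R : realType) (n : nat) (A B : set 'rV[R]_n) : R :=
  inf [set eudist x y | x in A & y in B].

Definition boundary (U : topologicalType) (A : set U) : set U :=
  closure A `\` interior A.

Definition ebounded (R : realType) (n : nat) (A : set 'rV[R]_n) : Prop :=
  exists M : R, forall x, A x -> enorm x <= M.

(* Near each boundary point the set lies strictly above the graph of a
   Lipschitz function over a hyperplane.  The hyperplane is given by its unit
   normal [e]; [x - (x.e) e] is the orthogonal projection of [x] onto it, and
   [g] is applied to that projection only.  Since D is open, the boundary of D
   is then locally the graph of [g].  For n = 1 this describes open intervals
   (possibly unbounded). *)
Definition lipschitz_domain (R : realType) (n : nat) (D : set 'rV[R]_n) : Prop :=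
  [/\ open D, connected D, D !=set0, boundary D !=set0 &
      compact (boundary D) /\
      forall x0, boundary D x0 ->
        exists r : R, exists e : 'rV[R]_n, exists g : 'rV[R]_n -> R,
        exists L : R,
        [/\ 0 < r, enorm e = 1,
            (forall x y, `|g x - g y| <= L * eudist x y) &
            forall x, eudist x x0 < r ->
              (D x <-> g (x - dotp x e *: e) < dotp x e)]].

Definition compact_lipschitz_domain (R : realType) (n : nat)
    (A : set 'rV[R]_n) : Prop :=
  exists D : set 'rV[R]_n,
    [/\ lipschitz_domain D, ebounded D & A = closure D].

Definition bi_lipschitz_on (R : realType) (m n : nat) (A : set 'rV[R]_m)
    (chi : 'rV[R]_m -> 'rV[R]_n) : Prop :=
  exists2 L : R, 0 < L &
    forall x y, A x -> A y ->
      L^-1 * eudist x y <= eudist (chi x) (chi y) <= L * eudist x y.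

(* R^n with its Borel sigma-algebra, and time-space R x R^n. *)
Notation Rn R n := (g_sigma_algebraType (@open 'rV[R]_n)).
Notation ST R n := (measurableTypeR R * Rn R n)%type.

Fixpoint unit_ball_volume (R : realType) (m : nat) : R :=
  match m with
  | 0 => 1
  | 1 => 2
  | m'.+2 => 2 * pi / m%:R * unit_ball_volume R m'
  end.

(* Normalised so that it is Lebesgue measure on R^m for n = m; only used for
   m >= 1 (an empty U i then contributes 0). *)
Definition hausdorff_pre (R : realType) (n m : nat) (delta : R)
    (A : set 'rV[R]_n) : \bar R :=
  ereal_inf
    [set (\sum_(0 <= i <oo)
            (unit_ball_volume R m * (diam (U i) / 2) ^+ m)%:E)%E
    | U in [set U : nat -> set 'rV[R]_n |
        A `<=` \bigcup_i U i /\
        forall i x y, U i x -> U i y -> eudist x y <= delta]].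

Definition hausdorff (R : realType) (n m : nat) (A : set 'rV[R]_n) : \bar R :=
  ereal_sup [set hausdorff_pre m delta A | delta in [set d : R | 0 < d]].

(* [sigma] is the surface measure of the hypersurface [Gamma], as a Borel
   measure on R^n concentrated on [Gamma]. *)
Definition surface_measure (R : realType) (n : nat) (Gamma : set 'rV[R]_n)
    (sigma : set (Rn R n) -> \bar R) : Prop :=
  forall A : set (Rn R n), measurable A ->
    sigma A = hausdorff n.-1 ((A : set 'rV[R]_n) `&` Gamma).

(* Squared (semi)norms take values in [\bar R]; functions are representatives
   of almost-everywhere classes. *)
Section Slobodeckij.
Context (R : realType) (n : nat) (sigma : {finite_measure set (Rn R n) -> \bar R}).
Local Open Scope ereal_scope.

Definition L2_norm2 (omega : set (Rn R n)) (w : Rn R n -> R) : \bar R :=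
  \int[sigma]_(x in omega) (w x ^+ 2)%:E.

(* The integrand vanishes on the diagonal since 0^-1 = 0. *)
Definition H_semi2 (mu : R) (omega : set (Rn R n)) (w : Rn R n -> R) : \bar R :=
  \int[sigma]_(x in omega) \int[sigma]_(y in omega)
    ((w x - w y) ^+ 2 / eudist x y `^ (n.-1%:R + 2 * mu))%:E.

Definition H_norm2 (mu : R) (omega : set (Rn R n)) (w : Rn R n -> R) : \bar R :=
  L2_norm2 omega w + H_semi2 mu omega w.

(* L_2(J;X) and H^nu(J;X), the space X of functions on R^n being given by its
   squared (semi)norm [normX2]. *)
Definition L2t_norm2 (J : set R) (normX2 : (Rn R n -> R) -> \bar R)
    (v : ST R n -> R) : \bar R :=
  \int[lebesgue_measure]_(t in J) normX2 (fun x => v (t, x)).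

Definition Ht_semi2 (nu : R) (J : set R) (normX2 : (Rn R n -> R) -> \bar R)
    (v : ST R n -> R) : \bar R :=
  \int[lebesgue_measure]_(t in J) \int[lebesgue_measure]_(s in J)
    (normX2 (fun x => v (t, x) - v (s, x))%R *
      ((`|t - s| `^ (1 + 2 * nu))^-1)%:E).

Definition Ht_norm2 (nu : R) (J : set R) (normX2 : (Rn R n -> R) -> \bar R)
    (v : ST R n -> R) : \bar R :=
  L2t_norm2 J normX2 v + Ht_semi2 nu J normX2 v.

Definition Haniso_norm2 (mu nu : R) (J : set R) (omega : set (Rn R n))
    (v : ST R n -> R) : \bar R :=
  L2t_norm2 J (H_norm2 mu omega) v + Ht_norm2 nu J (L2_norm2 omega) v.

Definition Haniso (mu nu : R) (J : set R) (omega : set (Rn R n)) :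
    set (ST R n -> R) :=
  [set v | measurable_fun (J `*` omega : set (ST R n)) v /\
           Haniso_norm2 mu nu J omega v < +oo].

End Slobodeckij.

Section SingleLayer.
Context (R : realType) (n : nat) (sigma : {finite_measure set (Rn R n) -> \bar R})
  (T : R) (Gamma : set (Rn R n)).

Definition lateral : set (ST R n) := `]0, T[%classic `*` Gamma.

Definition ae_eq_lateral (v w : ST R n -> R) : Prop :=
  {ae (lebesgue_measure \x sigma)%E, forall z, lateral z -> v z = w z}.

Definition Hplus : set (ST R n -> R) :=
  Haniso sigma (1 / 2) (1 / 4) `]0, T[%classic Gamma.

Definition Hplus_norm (v : ST R n -> R) : R :=
  Num.sqrt (fine (Haniso_norm2 sigma (1 / 2) (1 / 4) `]0, T[%classic Gamma v)).

(* H^{-1/2,-1/4}(Sigma): bounded linear functionals on [Hplus].  They are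
   extended by 0 outside [Hplus] so that equality of functionals is Leibniz
   equality; boundedness makes them compatible with equality almost
   everywhere. *)
Definition Hminus : set ((ST R n -> R) -> R) :=
  [set psi |
    [/\ forall v, ~ Hplus v -> psi v = 0,
        forall (a : R) v w, Hplus v -> Hplus w ->
          psi (fun z => a * v z + w z) = a * psi v + psi w &
        exists C : R, forall v, Hplus v -> `|psi v| <= C * Hplus_norm v]].

Definition Hminus_norm (psi : (ST R n -> R) -> R) : R :=
  sup [set `|psi v| | v in [set v | Hplus v /\ Hplus_norm v <= 1]].

Definition pairing (v : ST R n -> R) (psi : (ST R n -> R) -> R) : R := psi v.

Definition L2lateral : set (ST R n -> R) :=
  [set w | measurable_fun lateral w /\
    (L2t_norm2 `]0%R, T[%classic (L2_norm2 sigma Gamma) w < +oo)%E].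

(* Embedding of L_2(Sigma) into H^{-1/2,-1/4}(Sigma). *)
Definition of_L2 (w : ST R n -> R) : (ST R n -> R) -> R :=
  fun v => if `[< Hplus v >] then
    \int[lebesgue_measure]_(t in `]0, T[%classic) \int[sigma]_(x in Gamma)
      (v (t, x) * w (t, x))
  else 0.

Definition heat_kernel (t : R) (x : 'rV[R]_n) : R :=
  if 0 < t
  then (4 * pi * t) `^ (- (n%:R / 2)) * expR (- (enorm x ^+ 2 / (4 * t)))
  else 0.

Definition heat_potential (w : ST R n -> R) (z : ST R n) : R :=
  \int[(lebesgue_measure \x sigma)%E]_(y in lateral)
    (heat_kernel (z.1 - y.1) ((z.2 : 'rV[R]_n) - y.2) * w y).

(* The single-layer operator: the isomorphism H^{-1/2,-1/4}(Sigma) ->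
   H^{1/2,1/4}(Sigma) given on the dense subspace L_2(Sigma) by the heat
   potential; by boundedness this determines [V] up to equality almost
   everywhere of its values. *)
Record single_layer (V : ((ST R n -> R) -> R) -> (ST R n -> R)) : Prop := {
  single_layer_Hplus : forall psi, Hminus psi -> Hplus (V psi);
  single_layer_linear : forall (a : R) psi chi, Hminus psi -> Hminus chi ->
    ae_eq_lateral (V (fun v => a * psi v + chi v))
                  (fun z => a * V psi z + V chi z);
  single_layer_bounded : exists C : R, forall psi, Hminus psi ->
    Hplus_norm (V psi) <= C * Hminus_norm psi;
  single_layer_inj : forall psi chi, Hminus psi -> Hminus chi ->
    ae_eq_lateral (V psi) (V chi) -> psi = chi;
  single_layer_surj : forall g, Hplus g ->
    exists2 psi, Hminus psi & ae_eq_lateral (V psi) g;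
  single_layer_inv_bounded : exists C : R, forall psi, Hminus psi ->
    Hminus_norm psi <= C * Hplus_norm (V psi);
  single_layer_kernel : forall w, L2lateral w ->
    ae_eq_lateral (V (of_L2 w)) (heat_potential w)
}.

Definition single_layer_norm (V : ((ST R n -> R) -> R) -> (ST R n -> R)) : R :=
  sup [set Hplus_norm (V psi) |
       psi in [set psi | Hminus psi /\ Hminus_norm psi <= 1]].

Definition coercive_with (V : ((ST R n -> R) -> R) -> (ST R n -> R)) (c : R) :
    Prop :=
  0 < c /\ forall psi, Hminus psi ->
    c * Hminus_norm psi ^+ 2 <= pairing (V psi) psi.

Definition fin_dim_subspace (X : set ((ST R n -> R) -> R)) : Prop :=
  exists d : nat, exists b : 'I_d -> (ST R n -> R) -> R,
    (forall i, Hminus (b i)) /\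
    X = [set psi | exists c : 'I_d -> R, psi = fun v => \sum_(i < d) c i * b i v].

Definition galerkin (V : ((ST R n -> R) -> R) -> (ST R n -> R))
    (f : ST R n -> R) (X : set ((ST R n -> R) -> R))
    (Phi : (ST R n -> R) -> R) : Prop :=
  X Phi /\ forall Psi, X Psi -> pairing (V Phi) Psi = pairing f Psi.

End SingleLayer.

(* A prism J x K is the pair (J, K). *)
Notation prism R n := (set R * set (Rn R n))%type.

Definition len (R : realType) (J : set R) : R :=
  fine (lebesgue_measure (J : set (measurableTypeR R))).

Section Mesh.
Context (R : realType) (n : nat) (sigma : {finite_measure set (Rn R n) -> \bar R})
  (T : R) (Gamma : set (Rn R n)).

Definition is_prism (p : prism R n) : Prop :=
  (exists a b : R, [/\ a <= b, p.1 = `[a, b]%classic & p.1 `<=` `[0, T]%classic])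
  /\
  (p.2 `<=` Gamma /\
   exists Khat : set 'rV[R]_n.-1, exists chi : 'rV[R]_n.-1 -> 'rV[R]_n,
     [/\ compact_lipschitz_domain Khat, bi_lipschitz_on Khat chi &
         p.2 = chi @` Khat]).

Definition prismatic_mesh (P : set (prism R n)) : Prop :=
  [/\ finite_set P,
      forall p, P p -> is_prism p,
      forall p q, P p -> P q -> p <> q ->
        (lebesgue_measure \x sigma)%E
          ((p.1 `*` p.2) `&` (q.1 `*` q.2) : set (ST R n)) = 0%E &
      lateral T Gamma =
        (\bigcup_(p in P) (p.1 `*` p.2)) `&` (`]0, T[%classic `*` setT)].

Definition mesh_at_time (P : set (prism R n)) (t : R) : set (set (Rn R n)) :=
  [set K | exists2 J, P (J, K) & (([set t] `*` Gamma) `&` (J `*` K)) !=set0].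

Definition mesh_at_point (P : set (prism R n)) (x : Rn R n) : set (set R) :=
  [set J | exists2 K, P (J, K) &
    ((`[0, T]%classic `*` [set x]) `&` (J `*` K)) !=set0].

Definition ae_time (Q : R -> Prop) : Prop :=
  {ae lebesgue_measure, forall t : measurableTypeR R,
    `[0, T]%classic (t : R) -> Q t}.

Definition ae_point (Q : Rn R n -> Prop) : Prop :=
  {ae sigma, forall x, Gamma x -> Q x}.

Definition nei_const (P : set (prism R n)) (C : R) : Prop :=
  1 <= C /\ ae_time (fun t => forall K, mesh_at_time P t K ->
    (#|` fset_set [set K' | mesh_at_time P t K' /\ (K `&` K') !=set0]|)%:R <= C).

Definition dist_const (P : set (prism R n)) (C : R) : Prop :=
  1 <= C /\ ae_time (fun t => forall K K',
    mesh_at_time P t K -> mesh_at_time P t K' -> K `&` K' = set0 ->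
    diam K <= C * set_dist K K').

Definition shape_const (P : set (prism R n)) (C : R) : Prop :=
  1 <= C /\ ae_time (fun t => forall K, mesh_at_time P t K ->
    C^-1 * fine (sigma K) <= diam K ^+ n.-1 <= C * fine (sigma K)).

Definition lqu_const (P : set (prism R n)) (C : R) : Prop :=
  1 <= C /\ ae_point (fun x => forall J J',
    mesh_at_point P x J -> mesh_at_point P x J' -> (J `&` J') !=set0 ->
    len J <= C * len J').

(* Piecewise constant functions, up to their values on the (null) overlaps. *)
Definition pw_const (P : set (prism R n)) (c : prism R n -> R)
    (z : ST R n) : R :=
  \sum_(p \in P) (c p * \1_(p.1 `*` p.2) z).

Definition contains_pw_const (P : set (prism R n))
    (X : set ((ST R n -> R) -> R)) : Prop :=
  forall c : prism R n -> R, X (of_L2 sigma T Gamma (pw_const P c)).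

End Mesh.

(* [r] is the residual f - V Phi. *)
Section Estimators.
Context (R : realType) (n : nat) (sigma : {finite_measure set (Rn R n) -> \bar R})
  (P : set (prism R n)) (r : ST R n -> R).
Local Open Scope ereal_scope.

Definition nei_x (p : prism R n) : set (prism R n) :=
  [set q | [/\ P q, 0 < lebesgue_measure (p.1 `&` q.1 : set (measurableTypeR R))
              & (p.2 `&` q.2) !=set0]].

Definition nei_t (p : prism R n) : set (prism R n) :=
  [set q | [/\ P q, (p.1 `&` q.1) !=set0 & 0 < sigma (p.2 `&` q.2)]].

Definition eta_x2 (p : prism R n) : \bar R :=
  \sum_(q \in nei_x p)
    L2t_norm2 (p.1 `&` q.1) (H_semi2 sigma (1 / 2) (p.2 `|` q.2)) r.

Definition eta_t2 (p : prism R n) : \bar R :=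
  \sum_(q \in nei_t p)
    Ht_semi2 (1 / 4) (p.1 `|` q.1) (L2_norm2 sigma (p.2 `&` q.2)) r.

Definition zeta_x2 (p : prism R n) : \bar R :=
  ((diam p.2)^-1)%:E * L2t_norm2 p.1 (L2_norm2 sigma p.2) r.

Definition zeta_t2 (p : prism R n) : \bar R :=
  ((Num.sqrt (len p.1))^-1)%:E * L2t_norm2 p.1 (L2_norm2 sigma p.2) r.

Definition eta_loc2 (p : prism R n) : \bar R := eta_x2 p + eta_t2 p.

Definition zeta_loc2 (p : prism R n) : \bar R := zeta_x2 p + zeta_t2 p.

Definition eta2 : \bar R := \sum_(p \in P) eta_loc2 p.

Definition zeta2 : \bar R := \sum_(p \in P) zeta_loc2 p.

Definition eta : \bar R := sqrte eta2.

End Estimators.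

(* [eta2 sigma P v] is the sum of the localized seminorms of [v], with [v] in
   place of the residual. *)
Definition localization_const (R : realType) (n : nat)
    (sigma : {finite_measure set (Rn R n) -> \bar R}) (T : R)
    (Gamma : set (Rn R n)) (P : set (prism R n)) (C : R) : Prop :=
  0 < C /\ forall v, Hplus sigma T Gamma v ->
    ((C ^- 2 * Hplus_norm sigma T Gamma v ^+ 2)%:E <=
     eta2 sigma P v +
     \sum_(p \in P)
       ((diam p.2)^-1 + (Num.sqrt (len p.1))^-1)%:E *
         L2t_norm2 p.1 (L2_norm2 sigma p.2) v)%E.

(* Main.v *)
(** Efficiency is a counting argument.  By symmetry of the neighbour relation
    each local seminorm is at most twice the integral, over one prism, of the
    density [int_Gamma |v(t,x) - v(t,y)|^2 / |x - y|^n dy] (space) or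
    [int_I |v(t,x) - v(s,x)|^2 / |t - s|^(3/2) ds] (time).  Almost every point
    lies in one prism only, and is counted at most [C_nei] times in space and at
    most 4 times in time; in the time direction local quasi-uniformity rules out
    degenerate time intervals.  Boundedness of the operator then gives the lower
    bound in (a), and coercivity with the localization inequality the upper one.

    For (b) and (c), Galerkin orthogonality against the indicator of a prism
    makes the residual [r] mean-free on it, hence
    [2 |J| |K| ||r||^2 = int int (r(z) - r(w))^2].  Splitting the difference into
    a space and a time increment yields
    [||r||^2 <= C_shape diam(K) (eta^x)^2 + |J|^(1/2) (eta^t)^2].  Keeping the two
    parts separate is what makes the constant in (c) reach
    [2 C_shape (1 + C_grad)]. *)
Require Import Defs.
From mathcomp Require Import all_boot all_order all_algebra finmap.
From mathcomp Require Import all_classical all_reals all_analysis.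
From mathcomp Require Import measurable_realfun ring lra.

Set Implicit Arguments.
Unset Strict Implicit.
Unset Printing Implicit Defensive.

Import Order.TTheory GRing.Theory Num.Theory.
Import numFieldNormedType.Exports.

Local Open Scope classical_set_scope.
Local Open Scope ring_scope.

(** * Integration over products *)

(** Elements of [Hplus] are representatives that are measurable only on the lateral boundary, while
    prisms are closed in time and may contain the end times [0] and [T]. Integrals are therefore
    computed for the extension by zero, [restr_lateral], which is measurable everywhere; the two end
    times form a null set. For this function Tonelli turns each seminorm into the integral of a
    pointwise density over a product set, and bounding the estimator becomes a weighted count of how
    often a point is covered. Values of [V] are determined only almost everywhere, so the passage
    between the residual and [V (phi \- Phi)] rests on the invariance of the anisotropic norm under
    equality almost everywhere. The mesh conditions, too, hold only at almost every time or point.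
    Finiteness of the mesh makes them usable: all intersections of measure zero can be discarded at
    once, and at the remaining points prisms that meet in time and in space coincide. *)

Section Tonelli.
Context d1 d2 (X : measurableType d1) (Y : measurableType d2) (R : realType).
Local Open Scope ereal_scope.

(** Cutting [f] off outside the cylinder over [D] turns the set integral into a Fubini section
    function on the full space. Iterated integrals below get their measurability from here. *)
Lemma measurable_fun_integral (m : {sigma_finite_measure set Y -> \bar R})
    (D : set Y) (f : X * Y -> \bar R) :
  measurable D -> measurable_fun setT f -> (forall z, 0 <= f z) ->
  measurable_fun setT (fun x => \int[m]_(y in D) f (x, y)).
Proof.
move=> mD mf f0.
have mTD : measurable ([set: X] `*` D) by exact: measurableX.
have -> : (fun x => \int[m]_(y in D) f (x, y)) =
    fubini_F m (f \_ (setT `*` D)).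
  apply/funext => x; rewrite /fubini_F [LHS]integral_mkcond; apply: eq_integral => y _.
  by rewrite /patch; congr (if _ then _ else _); apply/idP/idP;
    rewrite !inE //= => -[].
apply: measurable_fun_fubini_tonelli_F => [|z]; last exact: erestrict_ge0.
by apply: (measurable_restrictT f mTD).1; exact: measurable_funTS.
Qed.

Variables (m1 : {sigma_finite_measure set X -> \bar R})
  (m2 : {sigma_finite_measure set Y -> \bar R}).
Variables (A : set X) (B : set Y) (f : X * Y -> \bar R).
Hypotheses (mA : measurable A) (mB : measurable B)
  (mf : measurable_fun setT f) (f0 : forall z, 0 <= f z).

Let mAB : measurable (A `*` B). Proof. exact: measurableX. Qed.

Let mfAB : measurable_fun setT (f \_ (A `*` B)).
Proof. by apply: (measurable_restrictT f mAB).1; exact: measurable_funTS. Qed.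

Let fAB0 z : 0 <= (f \_ (A `*` B)) z. Proof. exact: erestrict_ge0. Qed.

Lemma integral_setX :
  \int[(m1 \x m2)%E]_(z in A `*` B) f z =
  \int[m1]_(x in A) \int[m2]_(y in B) f (x, y).
Proof.
rewrite integral_mkcond fubini_tonelli1// [RHS]integral_mkcond.
congr (integral _ _ _); apply/funext => x; rewrite /fubini_F /patch; case: ifPn => xA.
  rewrite [RHS]integral_mkcond; congr (integral _ _ _); apply/funext => y; rewrite /patch.
  by congr (if _ then _ else _); apply/idP/idP; rewrite !inE; rewrite inE in xA;
    [case|move=> yB; split].
rewrite integral0_eq// => y _; case: ifPn => //.
by rewrite inE => -[/= + _]; rewrite -inE (negbTE xA).
Qed.

Lemma integral_swap :
  \int[m1]_(x in A) \int[m2]_(y in B) f (x, y) =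
  \int[m2]_(y in B) \int[m1]_(x in A) f (x, y).
Proof.
rewrite -integral_setX integral_mkcond fubini_tonelli2// [RHS]integral_mkcond.
congr (integral _ _ _); apply/funext => y; rewrite /fubini_G /patch; case: ifPn => yB.
  rewrite [RHS]integral_mkcond; congr (integral _ _ _); apply/funext => x; rewrite /patch.
  by congr (if _ then _ else _); apply/idP/idP; rewrite !inE; rewrite inE in yB;
    [case|move=> xA; split].
rewrite integral0_eq// => x _; case: ifPn => //.
by rewrite inE => -[/= _]; rewrite -inE (negbTE yB).
Qed.

End Tonelli.

Lemma measurable_fun_integral_setX d1 d2 d3 (W : measurableType d3)
    (X : measurableType d1) (Y : measurableType d2) (R : realType)
    (m1 : {sigma_finite_measure set X -> \bar R})
    (m2 : {sigma_finite_measure set Y -> \bar R}) (A : set X) (B : set Y)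
    (f : W * (X * Y) -> \bar R) :
  measurable A -> measurable B -> measurable_fun setT f ->
  (forall q, 0 <= f q)%E ->
  measurable_fun setT (fun w => \int[m1 \x m2]_(z in A `*` B) f (w, z))%E.
Proof.
move=> mA mB mf f0.
rewrite (_ : (fun w => _) =
    (fun w => \int[m1]_(x in A) \int[m2]_(y in B) f (w, (x, y)))%E); last first.
  apply/funext => w; apply: (integral_setX m1 m2 mA mB (f := fun z => f (w, z))) => //.
  exact: measurable_fun_pair2.
pose g (q : W * X) := (\int[m2]_(y in B) f (q.1, (q.2, y)))%E.
apply: (measurable_fun_integral m1 mA (f := g)) => [|q]; last exact: integral_ge0.
pose h (q : W * X * Y) := f (q.1.1, (q.1.2, q.2)).
apply: (measurable_fun_integral m2 mB (f := h)) => [|q]; last exact: f0.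
apply: (measurableT_comp mf (g := fun q : W * X * Y => (q.1.1, (q.1.2, q.2)))).
apply: measurable_fun_pair; first by apply: measurableT_comp => //; exact: measurable_fst.
apply: measurable_fun_pair => //.
by apply: measurableT_comp => //; exact: measurable_fst.
Qed.

Section AlmostEverywhereProduct.
Context d1 d2 (X : measurableType d1) (Y : measurableType d2) (R : realType).
Variables (m1 : {sigma_finite_measure set X -> \bar R})
  (m2 : {sigma_finite_measure set Y -> \bar R}).
Local Open Scope ereal_scope.

Lemma ae_prod_fst (Q : X -> Prop) : {ae m1, forall x, Q x} ->
  {ae (m1 \x m2), forall z, Q z.1}.
Proof.
move=> [N [mN N0 QN]]; exists (N `*` setT); split.
- exact: measurableX.
- by rewrite product_measure1E//; move: N0 => /= ->; rewrite mul0e.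
- by move=> [x y] /= h; split => //; exact: QN.
Qed.

Lemma ae_prod_snd (Q : Y -> Prop) : {ae m2, forall y, Q y} ->
  {ae (m1 \x m2), forall z, Q z.2}.
Proof.
move=> [N [mN N0 QN]]; exists (setT `*` N); split.
- exact: measurableX.
- by rewrite product_measure1E//; move: N0 => /= ->; rewrite mule0.
- by move=> [x y] /= h; split => //; exact: QN.
Qed.

(** The measures of the sections of the exceptional null set integrate to zero, so almost all of
    them vanish. *)
Lemma ae_prod_section (Q : X * Y -> Prop) : {ae (m1 \x m2), forall z, Q z} ->
  {ae m1, forall x, {ae m2, forall y, Q (x, y)}}.
Proof.
move=> [N [mN N0 QN]].
have mphi : measurable_fun setT (m2 \o xsection N).
  exact: measurable_fun_xsection.
have : \int[m1]_x `|(m2 \o xsection N) x| = 0.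
  by rewrite -N0; apply: eq_integral => x _; rewrite gee0_abs.
move=> /(ae_eq_integral_abs m1 measurableT mphi).
apply: filterS => x /(_ I) Nx.
exists (xsection N x); split => //; first exact: measurable_xsection.
by move=> y /= h; apply/xsectionP; exact: QN.
Qed.

Lemma ae_prod_ysection (Q : X * Y -> Prop) : {ae (m1 \x m2), forall z, Q z} ->
  {ae m2, forall y, {ae m1, forall x, Q (x, y)}}.
Proof.
move=> [N [mN N0 QN]].
have mpsi : measurable_fun setT (m1 \o ysection N).
  exact: measurable_fun_ysection.
have : \int[m2]_y `|(m1 \o ysection N) y| = 0.
  (* The product measure is given through x-sections; Tonelli for the indicator of [N] rewrites it
     through y-sections. *)
  rewrite -N0 -(indic_fubini_tonelli_GE m1 mN).
  transitivity (\int[m1]_x fubini_F m2 (EFin \o \1_N) x).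
    rewrite (indic_fubini_tonelli m1 m2 mN); apply: eq_integral => y _.
    by rewrite gee0_abs// indic_fubini_tonelli_G_ge0.
  by apply: eq_integral => x _; rewrite indic_fubini_tonelli_FE.
move=> /(ae_eq_integral_abs m2 measurableT mpsi).
apply: filterS => y /(_ I) Ny.
exists (ysection N y); split => //; first exact: measurable_ysection.
by move=> x /= h; apply/ysectionP; exact: QN.
Qed.

End AlmostEverywhereProduct.
(** * Slobodeckij seminorms as iterated integrals *)

Section RnMeasurability.
Context (R : realType) (n : nat).

Lemma open_measurable_Rn (A : set 'rV[R]_n) :
  open A -> measurable (A : set (Rn R n)).
Proof. exact: sub_gen_smallest. Qed.

Lemma closed_measurable_Rn (A : set 'rV[R]_n) :
  closed A -> measurable (A : set (Rn R n)).
Proof.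
by move=> cA; rewrite -[A]setCK; apply: measurableC; apply: open_measurable_Rn;
  exact: closed_openC.
Qed.

Lemma measurable_coord (i : 'I_n) :
  measurable_fun setT (fun x : Rn R n => (x : 'rV[R]_n) 0 i).
Proof.
apply: (measurability _ (RGenOInfty.measurableE R)) => _ [_ [a ->] <-].
rewrite setTI; apply: open_measurable_Rn.
apply: open_comp; last exact: interval_open.
by move=> x _; exact: coord_continuous.
Qed.

Lemma eudist_ge0 (x y : 'rV[R]_n) : 0 <= eudist x y.
Proof. exact: sqrtr_ge0. Qed.

Lemma measurable_eudist :
  measurable_fun setT (fun z : Rn R n * Rn R n => eudist (z.1 : 'rV[R]_n) z.2).
Proof.
have dE (x : 'rV[R]_n) : dotp x x = \sum_i x 0 i ^+ 2.
  by apply: eq_bigr => i _; rewrite expr2.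
rewrite (_ : (fun z => _) = (@powR R ^~ 2^-1) \o (fun z : Rn R n * Rn R n =>
    \sum_i ((z.1 : 'rV[R]_n) 0 i - (z.2 : 'rV[R]_n) 0 i) ^+ 2)).
  apply: measurableT_comp; first exact: measurable_powR.
  apply: measurable_sum => i; apply: measurable_funX; apply: measurable_funB.
    by apply: (measurableT_comp (measurable_coord i)); exact: measurable_fst.
  by apply: (measurableT_comp (measurable_coord i)); exact: measurable_snd.
apply/funext => z /=; rewrite /eudist /enorm dE powR12_sqrt.
  by congr Num.sqrt; apply: eq_bigr => i _; rewrite !mxE.
by apply: sumr_ge0 => i _; exact: sqr_ge0.
Qed.

End RnMeasurability.

Section Endpoints.
Context (R : realType).
Local Open Scope ereal_scope.

(** Prisms are closed in time, but functions on the lateral boundary are controlled only for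
    [0 < t < T]. Measurability of [f] need not be assumed: on [J] it is the measurable [g], altered
    in at most two points. *)
Lemma eq_integral_interior (T : R) (J : set R) (f g : R -> \bar R) :
  measurable (J : set (measurableTypeR R)) -> J `<=` `[0%R, T]%classic ->
  measurable_fun (setT : set (measurableTypeR R)) g ->
  (forall t, 0 <= f t) -> (forall t, 0 <= g t) ->
  (forall t, J t -> `]0%R, T[%classic t -> f t = g t) ->
  \int[lebesgue_measure]_(t in J) f t = \int[lebesgue_measure]_(t in J) g t.
Proof.
move=> mJ JT mg f0 g0 fg.
(* A function visibly measurable and equal to [f] on [J]: [g] with its values at the end times
   overwritten. *)
have fJ : {in J, (fun t => if t == 0%R then f 0%R else
    if t == T then f T else g t) =1 f}.
  move=> t; rewrite inE => Jt; have := JT _ Jt; rewrite /= in_itv/= => /andP[t0 tT].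
  have [->//|tn0] := eqVneq t 0%R; have [->//|tnT] := eqVneq t T.
  by rewrite fg//= in_itv/= !lt_neqAle t0 tT eq_sym tn0 tnT.
apply: ge0_ae_eq_integral => //.
- apply: (eq_measurable_fun _ fJ).
  apply: (@measurable_funTS _ _ (measurableTypeR R)).
  by apply: measurable_fun_ifT => //; [exact: measurable_fun_eqr|
    apply: measurable_fun_ifT => //; exact: measurable_fun_eqr].
- exact: measurable_funTS.
exists [set 0%R; T]; split.
- by apply: measurableU; exact: measurable_set1.
- rewrite measureU0 //; by [exact: lebesgue_measure_set1|exact: measurable_set1].
- move=> t /= /not_implyP[Jt]; apply: contra_notP => /not_orP[t0 tT]; apply: fg => //.
  have := JT _ Jt; rewrite /= !in_itv/= !lt_neqAle => /andP[-> ->].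
  by rewrite !andbT eq_sym; apply/andP; split; exact/eqP.
Qed.

End Endpoints.

Section Seminorms.
Context (R : realType) (n : nat)
  (sigma : {finite_measure set (Rn R n) -> \bar R}).
Implicit Types (J : set R) (omega : set (Rn R n)) (u v : ST R n -> R).

(* The integrands of [H_semi2] (mu = 1/2) and [Ht_semi2] (nu = 1/4). *)
Definition diffx u (z : ST R n) (y : Rn R n) : \bar R :=
  ((u z - u (z.1, y)) ^+ 2 /
    eudist (z.2 : 'rV[R]_n) y `^ (n.-1%:R + 2 * (1 / 2)))%:E.

Definition difft u (z : ST R n) (s : R) : \bar R :=
  ((u z - u (s, z.2)) ^+ 2 * (`|z.1 - s| `^ (1 + 2 * (1 / 4)))^-1)%:E.

Lemma diffx_ge0 u z y : (0 <= diffx u z y)%E.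
Proof. by rewrite lee_fin divr_ge0 ?sqr_ge0 ?powR_ge0. Qed.

Lemma difft_ge0 u z s : (0 <= difft u z s)%E.
Proof. by rewrite lee_fin divr_ge0 ?sqr_ge0 ?powR_ge0. Qed.

Lemma measurable_diffx u : measurable_fun setT u ->
  measurable_fun setT (fun q : ST R n * Rn R n => diffx u q.1 q.2).
Proof.
move=> mu; apply/measurable_EFinP; apply: measurable_funM.
  apply: measurable_funX; apply: measurable_funB.
    by apply: (measurableT_comp mu); exact: measurable_fst.
  apply: (measurableT_comp mu); apply: measurable_fun_pair => //.
  by apply: measurableT_comp => //; exact: measurable_fst.
rewrite (_ : (fun q => _) = (@powR R ^~ (- (n.-1%:R + 2 * (1 / 2)))) \o
  (fun z : Rn R n * Rn R n => eudist (z.1 : 'rV[R]_n) z.2) \o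
  (fun q : ST R n * Rn R n => (q.1.2, q.2))); last first.
  by apply/funext => q /=; rewrite powRN.
apply: measurableT_comp; last first.
  apply: measurable_fun_pair => //.
  by apply: measurableT_comp => //; exact: measurable_fst.
by apply: measurableT_comp; [exact: measurable_powR|exact: measurable_eudist].
Qed.

Lemma measurable_difft u : measurable_fun setT u ->
  measurable_fun setT (fun q : ST R n * measurableTypeR R => difft u q.1 q.2).
Proof.
move=> mu; apply/measurable_EFinP; apply: measurable_funM.
  apply: measurable_funX; apply: measurable_funB.
    by apply: (measurableT_comp mu); exact: measurable_fst.
  apply: (measurableT_comp mu); apply: measurable_fun_pair => //.
  by apply: measurableT_comp => //; exact: measurable_fst.
rewrite (_ : (fun q => _) = (@powR R ^~ (- (1 + 2 * (1 / 4)))) \o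
  (fun q : ST R n * measurableTypeR R => `|q.1.1 - q.2|)); last first.
  by apply/funext => q /=; rewrite powRN.
apply: measurableT_comp; first exact: measurable_powR.
apply: measurableT_comp; first exact: normr_measurable.
apply: measurable_funB => //.
by apply: measurableT_comp => //; exact: measurable_fst.
Qed.

Lemma measurable_int_diffx u omega : measurable_fun setT u ->
  measurable omega ->
  measurable_fun setT (fun z => \int[sigma]_(y in omega) diffx u z y)%E.
Proof.
move=> mu mo; apply: (measurable_fun_integral sigma mo (measurable_diffx mu)).
by move=> z; exact: diffx_ge0.
Qed.

Lemma measurable_int_difft u J : measurable_fun setT u ->
  measurable (J : set (measurableTypeR R)) ->
  measurable_fun setT (fun z => \int[lebesgue_measure]_(s in J) difft u z s)%E.
Proof.
move=> mu mJ.
apply: (measurable_fun_integral lebesgue_measure mJ (measurable_difft mu)).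
by move=> z; exact: difft_ge0.
Qed.

Lemma measurable_int_sqr u omega : measurable_fun setT u -> measurable omega ->
  measurable_fun (setT : set (measurableTypeR R))
    (fun t => L2_norm2 sigma omega (fun x => u (t, x))).
Proof.
move=> mu mo.
apply: (measurable_fun_integral sigma mo (f := fun z => (u z ^+ 2)%:E)).
  by apply/measurable_EFinP; exact: measurable_funX.
by move=> z; rewrite lee_fin sqr_ge0.
Qed.

Lemma measurable_H_semi2 u omega : measurable_fun setT u -> measurable omega ->
  measurable_fun (setT : set (measurableTypeR R))
    (fun t => H_semi2 sigma (1 / 2) omega (fun x => u (t, x))).
Proof.
move=> mu mo.
apply: (measurable_fun_integral sigma mo (measurable_int_diffx mu mo)) => z.
by apply: integral_ge0 => y _; exact: diffx_ge0.
Qed.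

Lemma L2_norm2_diffE u omega t s : measurable_fun setT u -> measurable omega ->
  (L2_norm2 sigma omega (fun x => u (t, x) - u (s, x))%R *
    ((`|t - s| `^ (1 + 2 * (1 / 4)))^-1)%:E)%E =
  (\int[sigma]_(x in omega) difft u (t, x) s)%E.
Proof.
move=> mu mo; rewrite /L2_norm2 -ge0_integralZr//.
- apply/measurable_EFinP; apply: measurable_funX; apply: measurable_funTS.
  apply: measurable_funB;
    exact: (measurable_fun_pair2 _ mu).
- by move=> x _; rewrite lee_fin sqr_ge0.
Qed.

(** With the integral in [s] innermost, the seminorm is the integral of a density in the point
    [(t, x)], the form needed for counting prisms over a point. *)
Lemma Ht_semi2E u J omega : measurable_fun setT u -> measurable omega ->
  measurable (J : set (measurableTypeR R)) ->
  Ht_semi2 (1 / 4) J (L2_norm2 sigma omega) u =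
  (\int[lebesgue_measure]_(t in J) \int[sigma]_(x in omega)
    \int[lebesgue_measure]_(s in J) difft u (t, x) s)%E.
Proof.
move=> mu mo mJ; apply: eq_integral => t _.
under eq_integral do rewrite L2_norm2_diffE//.
pose F (q : measurableTypeR R * Rn R n) := difft u (t, q.2) q.1.
apply: (integral_swap lebesgue_measure sigma mJ mo (f := F)).
  rewrite /F; apply: (measurableT_comp (measurable_difft mu)
    (g := fun q : measurableTypeR R * Rn R n => ((t, q.2), q.1))).
  by apply: measurable_fun_pair => //; exact: measurable_fun_pair.
by move=> q; exact: difft_ge0.
Qed.

Lemma measurable_Ht_semi2 u J omega : measurable_fun setT u ->
  measurable omega -> measurable (J : set (measurableTypeR R)) ->
  measurable_fun (setT : set (measurableTypeR R)) (fun t =>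
    \int[lebesgue_measure]_(s in J)
      (L2_norm2 sigma omega (fun x => u (t, x) - u (s, x))%R *
        ((`|t - s| `^ (1 + 2 * (1 / 4)))^-1)%:E))%E.
Proof.
move=> mu mo mJ.
rewrite (_ : (fun t => _) = (fun t => \int[lebesgue_measure]_(s in J)
    \int[sigma]_(x in omega) difft u (t, x) s)%E); last first.
  by apply/funext => t; apply: eq_integral => s _; rewrite L2_norm2_diffE.
pose F (q : measurableTypeR R * measurableTypeR R) :=
  (\int[sigma]_(x in omega) difft u (q.1, x) q.2)%E.
apply: (measurable_fun_integral lebesgue_measure mJ (f := F)); last first.
  by move=> q; apply: integral_ge0 => x _; exact: difft_ge0.
pose G (q : measurableTypeR R * measurableTypeR R * Rn R n) :=
  difft u (q.1.1, q.2) q.1.2.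
apply: (measurable_fun_integral sigma mo (f := G)); last first.
  by move=> q; exact: difft_ge0.
apply: (measurableT_comp (measurable_difft mu)
  (g := fun q : measurableTypeR R * measurableTypeR R * Rn R n =>
    ((q.1.1, q.2), q.1.2))).
apply: measurable_fun_pair; last first.
  by apply: measurableT_comp => //; exact: measurable_fst.
by apply: measurable_fun_pair => //; apply: measurableT_comp => //;
  exact: measurable_fst.
Qed.

Section Restriction.
Context (T : R) (Gamma : set (Rn R n)) (v : ST R n -> R).
Hypotheses (mGamma : measurable Gamma)
  (mv : measurable_fun (lateral T Gamma) v).

(** Membership in [Hplus] yields measurability on the lateral boundary only; the extension by zero
    is measurable everywhere, so the Tonelli lemmas apply to it. *)
Definition restr_lateral : ST R n -> R := v \_ (lateral T Gamma).

Lemma measurable_lateral : measurable (lateral T Gamma).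
Proof. by apply: measurableX => //; exact: measurable_itv. Qed.

Lemma measurable_restr_lateral : measurable_fun setT restr_lateral.
Proof. exact: (measurable_restrictT v measurable_lateral).1. Qed.

Lemma restr_lateralE t x :
  `]0, T[%classic t -> Gamma x -> restr_lateral (t, x) = v (t, x).
Proof. by move=> It Gx; rewrite /restr_lateral patchE mem_set. Qed.

Context (J : set R) (omega : set (Rn R n)).
Hypotheses (mJ : measurable (J : set (measurableTypeR R)))
  (JT : J `<=` `[0, T]%classic) (mo : measurable omega)
  (oG : omega `<=` Gamma).

Let mu := measurable_restr_lateral.

Lemma L2t_L2_restr : L2t_norm2 J (L2_norm2 sigma omega) v =
  L2t_norm2 J (L2_norm2 sigma omega) restr_lateral.
Proof.
apply: (eq_integral_interior mJ JT); first exact: measurable_int_sqr.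
- by move=> t; apply: integral_ge0 => x _; rewrite lee_fin sqr_ge0.
- by move=> t; apply: integral_ge0 => x _; rewrite lee_fin sqr_ge0.
move=> t _ It; apply: eq_integral => x /[!inE] /oG Gx.
by rewrite restr_lateralE.
Qed.

Lemma L2t_Hsemi_restr : L2t_norm2 J (H_semi2 sigma (1 / 2) omega) v =
  L2t_norm2 J (H_semi2 sigma (1 / 2) omega) restr_lateral.
Proof.
have ge0 (w : Rn R n -> R) : (0 <= H_semi2 sigma (1 / 2) omega w)%E.
  apply: integral_ge0 => x _; apply: integral_ge0 => y _.
  by rewrite lee_fin divr_ge0 ?sqr_ge0 ?powR_ge0.
apply: (eq_integral_interior mJ JT).
- exact: measurable_H_semi2.
- by move=> t; exact: ge0.
- by move=> t; exact: ge0.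
move=> t _ It; apply: eq_integral => x /[!inE] /oG Gx.
by apply: eq_integral => y /[!inE] /oG Gy; rewrite !restr_lateralE.
Qed.

Lemma Ht_semi_restr : Ht_semi2 (1 / 4) J (L2_norm2 sigma omega) v =
  Ht_semi2 (1 / 4) J (L2_norm2 sigma omega) restr_lateral.
Proof.
have ge0 (w : ST R n -> R) t s :
    (0 <= L2_norm2 sigma omega (fun x => w (t, x) - w (s, x))%R *
      ((`|t - s| `^ (1 + 2 * (1 / 4)))^-1)%:E)%E.
  apply: mule_ge0; last by rewrite lee_fin invr_ge0 powR_ge0.
  by apply: integral_ge0 => x _; rewrite lee_fin sqr_ge0.
apply: (eq_integral_interior mJ JT); first exact: measurable_Ht_semi2.
- by move=> t; apply: integral_ge0 => s _; exact: ge0.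
- by move=> t; apply: integral_ge0 => s _; exact: ge0.
(* The end times have to be discarded once more, in the inner variable [s]. *)
move=> t _ It; apply: (eq_integral_interior mJ JT) => //.
  rewrite (_ : (fun s => _) = (fun s =>
      \int[sigma]_(x in omega) difft restr_lateral (t, x) s)%E); last first.
    by apply/funext => s; rewrite L2_norm2_diffE.
  pose G (q : measurableTypeR R * Rn R n) := difft restr_lateral (t, q.2) q.1.
  apply: (measurable_fun_integral sigma mo (f := G)); last first.
    by move=> q; exact: difft_ge0.
  apply: (measurableT_comp (measurable_difft mu)
    (g := fun q : measurableTypeR R * Rn R n => ((t, q.2), q.1))).
  by apply: measurable_fun_pair => //; exact: measurable_fun_pair.
move=> s _ Is; congr (_ * _)%E.
by apply: eq_integral => x /[!inE] /oG Gx; rewrite !restr_lateralE.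
Qed.

End Restriction.

End Seminorms.
(** * The anisotropic norm on the lateral boundary *)

Section LateralNorm.
Context (R : realType) (n : nat)
  (sigma : {finite_measure set (Rn R n) -> \bar R}) (T : R)
  (Gamma : set (Rn R n)).
Hypothesis mGamma : measurable Gamma.
Implicit Types (u v w : ST R n -> R).

Local Notation I := (`]0, T[%classic : set R).
Local Notation lat := (lateral T Gamma).
Local Notation prod_measure := (@lebesgue_measure R \x sigma)%E.
Local Notation norm2 := (Haniso_norm2 sigma (1 / 2) (1 / 4) I Gamma).

Let mI : measurable (I : set (measurableTypeR R)).
Proof. exact: measurable_itv. Qed.

Let mlat : measurable lat. Proof. exact: measurable_lateral. Qed.

Definition lat_L2 u : \bar R := \int[prod_measure]_(z in lat) (u z ^+ 2)%:E.

Definition lat_semix u : \bar R :=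
  \int[prod_measure]_(z in lat) \int[sigma]_(y in Gamma) diffx u z y.

Definition lat_semit u : \bar R :=
  \int[prod_measure]_(z in lat) \int[lebesgue_measure]_(s in I) difft u z s.

Lemma lat_L2_ge0 u : (0 <= lat_L2 u)%E.
Proof. by apply: integral_ge0 => z _; rewrite lee_fin sqr_ge0. Qed.

Lemma lat_semix_ge0 u : (0 <= lat_semix u)%E.
Proof.
by apply: integral_ge0 => z _; apply: integral_ge0 => y _; exact: diffx_ge0.
Qed.

Lemma lat_semit_ge0 u : (0 <= lat_semit u)%E.
Proof.
by apply: integral_ge0 => z _; apply: integral_ge0 => y _; exact: difft_ge0.
Qed.

Lemma L2t_L2E u J omega : measurable_fun setT u ->
  measurable (J : set (measurableTypeR R)) -> measurable omega ->
  L2t_norm2 J (L2_norm2 sigma omega) u =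
  (\int[prod_measure]_(z in J `*` omega) (u z ^+ 2)%:E)%E.
Proof.
move=> mu mJ mo; apply/esym.
apply: (integral_setX lebesgue_measure sigma mJ mo) => [|z].
  by apply/measurable_EFinP; exact: measurable_funX.
by rewrite lee_fin sqr_ge0.
Qed.

Lemma Haniso_norm2E u : measurable_fun setT u ->
  norm2 u = (lat_L2 u + lat_semix u + (lat_L2 u + lat_semit u))%E.
Proof.
move=> mu; rewrite /Haniso_norm2 /Ht_norm2; congr (_ + (_ + _))%E.
- rewrite /L2t_norm2 /H_norm2 ge0_integralD//.
  + congr (_ + _)%E; first exact: L2t_L2E.
    apply/esym; apply: (integral_setX lebesgue_measure sigma mI mGamma).
      exact: measurable_int_diffx.
    by move=> z; apply: integral_ge0 => y _; exact: diffx_ge0.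
  + by move=> t _; apply: integral_ge0 => x _; rewrite lee_fin sqr_ge0.
  + by apply: measurable_funTS; exact: measurable_int_sqr.
  + move=> t _; apply: integral_ge0 => x _; apply: integral_ge0 => y _.
    exact: (diffx_ge0 u (t, x) y).
  + by apply: measurable_funTS; exact: measurable_H_semi2.
- exact: L2t_L2E.
- rewrite Ht_semi2E//; apply/esym.
  apply: (integral_setX lebesgue_measure sigma mI mGamma).
    exact: measurable_int_difft.
  by move=> z; apply: integral_ge0 => s _; exact: difft_ge0.
Qed.

Lemma eq_Haniso_norm2 v r :
  (forall t x, I t -> Gamma x -> r (t, x) = v (t, x)) -> norm2 v = norm2 r.
Proof.
move=> rE.
have L2E t : I t -> L2_norm2 sigma Gamma (fun x => v (t, x)) =
    L2_norm2 sigma Gamma (fun x => r (t, x)).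
  by move=> It; apply: eq_integral => x /[!inE] Gx; rewrite rE.
have e1 : L2t_norm2 I (H_norm2 sigma (1 / 2) Gamma) v =
    L2t_norm2 I (H_norm2 sigma (1 / 2) Gamma) r.
  apply: eq_integral => t /[!inE] It; rewrite /H_norm2 (L2E _ It).
  have -> // : H_semi2 sigma (1 / 2) Gamma (fun x => v (t, x)) =
    H_semi2 sigma (1 / 2) Gamma (fun x => r (t, x)).
  apply: eq_integral => x /[!inE] Gx.
  by apply: eq_integral => y /[!inE] Gy; rewrite !rE.
have e2 : L2t_norm2 I (L2_norm2 sigma Gamma) v =
    L2t_norm2 I (L2_norm2 sigma Gamma) r.
  by apply: eq_integral => t /[!inE] It; rewrite L2E.
have e3 : Ht_semi2 (1 / 4) I (L2_norm2 sigma Gamma) v =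
    Ht_semi2 (1 / 4) I (L2_norm2 sigma Gamma) r.
  apply: eq_integral => t /[!inE] It; apply: eq_integral => s /[!inE] Is.
  by congr (_ * _)%E; apply: eq_integral => x /[!inE] Gx; rewrite !rE.
by rewrite /Haniso_norm2 /Ht_norm2 e1 e2 e3.
Qed.

Lemma Haniso_norm2_restr v : norm2 v = norm2 (restr_lateral T Gamma v).
Proof. by apply: eq_Haniso_norm2 => t x; exact: restr_lateralE. Qed.

(** The kernels compare values at two points with the same time, or with the same space coordinate.
    Equality almost everywhere must therefore be passed on to almost every slice in either
    direction, by [ae_prod_section] and [ae_prod_ysection]. *)
Lemma lat_ae_eq u w : measurable_fun setT u -> measurable_fun setT w ->
  {ae prod_measure, forall z, u z = w z} ->
  [/\ lat_L2 u = lat_L2 w, lat_semix u = lat_semix w &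
      lat_semit u = lat_semit w].
Proof.
move=> mu mw uw; split.
- apply: ge0_ae_eq_integral => //.
  + by apply/measurable_EFinP; apply: measurable_funTS; exact: measurable_funX.
  + by apply/measurable_EFinP; apply: measurable_funTS; exact: measurable_funX.
  + by move=> z _; rewrite lee_fin sqr_ge0.
  + by move=> z _; rewrite lee_fin sqr_ge0.
  + by move: uw; apply: filterS => z + _ => ->.
- apply: ge0_ae_eq_integral => //.
  + by apply: measurable_funTS; exact: measurable_int_diffx.
  + by apply: measurable_funTS; exact: measurable_int_diffx.
  + by move=> z _; apply: integral_ge0 => y _; exact: diffx_ge0.
  + by move=> z _; apply: integral_ge0 => y _; exact: diffx_ge0.
  + have := ae_prod_fst sigma (ae_prod_section uw).
    move: uw; apply: filterS2 => z uwz uwt _.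
    apply: ge0_ae_eq_integral => //.
    * apply: measurable_funTS.
      exact: (measurable_fun_pair2 z (measurable_diffx mu)).
    * apply: measurable_funTS.
      exact: (measurable_fun_pair2 z (measurable_diffx mw)).
    * by move=> y _; exact: diffx_ge0.
    * by move=> y _; exact: diffx_ge0.
    * by move: uwt; apply: filterS => y uwy _; rewrite /diffx uwz uwy.
- apply: ge0_ae_eq_integral => //.
  + by apply: measurable_funTS; exact: measurable_int_difft.
  + by apply: measurable_funTS; exact: measurable_int_difft.
  + by move=> z _; apply: integral_ge0 => y _; exact: difft_ge0.
  + by move=> z _; apply: integral_ge0 => y _; exact: difft_ge0.
  + have := ae_prod_snd lebesgue_measure (ae_prod_ysection uw).
    move: uw; apply: filterS2 => z uwz uwt _.
    apply: ge0_ae_eq_integral => //.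
    * apply: measurable_funTS.
      exact: (measurable_fun_pair2 z (measurable_difft mu)).
    * apply: measurable_funTS.
      exact: (measurable_fun_pair2 z (measurable_difft mw)).
    * by move=> s _; exact: difft_ge0.
    * by move=> s _; exact: difft_ge0.
    * by move: uwt; apply: filterS => s uws _; rewrite /difft uwz uws.
Qed.

Lemma Haniso_norm2_ae_eq v w : measurable_fun lat v -> measurable_fun lat w ->
  ae_eq_lateral sigma T Gamma v w -> norm2 v = norm2 w.
Proof.
move=> mv mw vw; apply: (etrans (Haniso_norm2_restr v)); apply/esym.
apply: (etrans (Haniso_norm2_restr w)).
have mv' := measurable_restr_lateral mGamma mv.
have mw' := measurable_restr_lateral mGamma mw.
apply: (etrans (Haniso_norm2E mw')); apply/esym.
apply: (etrans (Haniso_norm2E mv')).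
have [|-> -> -> //] := lat_ae_eq mv' mw'.
move: vw; apply: filterS => z vw; rewrite /restr_lateral !patchE.
by case: ifPn => // /[!inE]; exact: vw.
Qed.

Lemma Haniso_norm2Z v (a : R) : measurable_fun lat v ->
  norm2 (fun z => a * v z) = ((a ^+ 2)%:E * norm2 v)%E.
Proof.
move=> mv; pose u := restr_lateral T Gamma v.
have mu : measurable_fun setT u by exact: measurable_restr_lateral.
have mau : measurable_fun setT (fun z => a * u z).
  by apply: measurable_funM => //; exact: measurable_cst.
have a2 : (0 <= (a ^+ 2)%:E)%E by rewrite lee_fin sqr_ge0.
have uE t x : I t -> Gamma x -> u (t, x) = v (t, x) by exact: restr_lateralE.
clearbody u.
rewrite (eq_Haniso_norm2 uE) (@eq_Haniso_norm2 _ (fun z => a * u z)); last first.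
  by move=> t x It Gx; rewrite uE.
rewrite !Haniso_norm2E//.
have -> : lat_L2 (fun z => a * u z) = ((a ^+ 2)%:E * lat_L2 u)%E.
  rewrite -ge0_integralZl//.
  - by apply: eq_integral => z _; rewrite exprMn EFinM.
  - by apply/measurable_EFinP; apply: measurable_funTS; exact: measurable_funX.
  - by move=> z _; rewrite lee_fin sqr_ge0.
have -> : lat_semix (fun z => a * u z) = ((a ^+ 2)%:E * lat_semix u)%E.
  rewrite -ge0_integralZl//.
  - apply: eq_integral => z _; rewrite -ge0_integralZl//.
    + by apply: eq_integral => y _; rewrite /diffx -EFinM -mulrBr exprMn -mulrA.
    + apply: measurable_funTS.
      exact: (measurable_fun_pair2 z (measurable_diffx mu)).
    + by move=> y _; exact: diffx_ge0.
  - by apply: measurable_funTS; exact: measurable_int_diffx.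
  - by move=> z _; apply: integral_ge0 => y _; exact: diffx_ge0.
have -> : lat_semit (fun z => a * u z) = ((a ^+ 2)%:E * lat_semit u)%E.
  rewrite -ge0_integralZl//.
  - apply: eq_integral => z _; rewrite -ge0_integralZl//.
    + by apply: eq_integral => y _; rewrite /difft -EFinM -mulrBr exprMn -mulrA.
    + apply: measurable_funTS.
      exact: (measurable_fun_pair2 z (measurable_difft mu)).
    + by move=> y _; exact: difft_ge0.
  - by apply: measurable_funTS; exact: measurable_int_difft.
  - by move=> z _; apply: integral_ge0 => y _; exact: difft_ge0.
have l0 := lat_L2_ge0 u; have x0 := lat_semix_ge0 u; have t0 := lat_semit_ge0 u.
by rewrite (ge0_muleDr _ (adde_ge0 l0 x0) (adde_ge0 l0 t0))
  (ge0_muleDr _ l0 x0) (ge0_muleDr _ l0 t0).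
Qed.

(** Constants supply the zero element of [Hplus] and, for [c = 1], an element of positive norm that
    shows the operator norm of [V] to be nonzero. *)
Lemma Haniso_norm2_cst (c : R) :
  norm2 (cst c) = ((c ^+ 2 *+ 2)%:E * (lebesgue_measure I * sigma Gamma))%E.
Proof.
rewrite Haniso_norm2E; last exact: measurable_cst.
have -> : lat_L2 (cst c) = ((c ^+ 2)%:E * (lebesgue_measure I * sigma Gamma))%E.
  rewrite /lat_L2 -(product_measure1E _ sigma mI mGamma).
  exact: (integral_cst prod_measure mlat (c ^+ 2)%:E).
have -> : lat_semix (cst c) = 0%E.
  apply: integral0_eq => z _; apply: integral0_eq => y _.
  by rewrite /diffx subrr expr0n mul0r.
have -> : lat_semit (cst c) = 0%E.
  apply: integral0_eq => z _; apply: integral0_eq => s _.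
  by rewrite /difft subrr expr0n mul0r.
rewrite !adde0 -ge0_muleDl ?lee_fin ?sqr_ge0//.
Qed.

Lemma Haniso_norm2_ge0 v : (0 <= norm2 v)%E.
Proof.
apply: adde_ge0; last apply: adde_ge0.
- apply: integral_ge0 => t _; apply: adde_ge0.
    by apply: integral_ge0 => x _; rewrite lee_fin sqr_ge0.
  by apply: integral_ge0 => x _; apply: integral_ge0 => y _;
    exact: (diffx_ge0 v (t, x) y).
- apply: integral_ge0 => t _.
  by apply: integral_ge0 => x _; rewrite lee_fin sqr_ge0.
- apply: integral_ge0 => t _; apply: integral_ge0 => s _; apply: mule_ge0.
    by apply: integral_ge0 => x _; rewrite lee_fin sqr_ge0.
  by rewrite lee_fin invr_ge0 powR_ge0.
Qed.

Lemma Hplus_norm_ge0 v : 0 <= Hplus_norm sigma T Gamma v.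
Proof. exact: sqrtr_ge0. Qed.

Lemma Hplus_normE v : Hplus sigma T Gamma v ->
  ((Hplus_norm sigma T Gamma v ^+ 2)%:E = norm2 v)%E.
Proof.
case=> _ v_fin; have v0 := Haniso_norm2_ge0 v.
by rewrite sqr_sqrtr ?fine_ge0// fineK// ge0_fin_numE.
Qed.

Lemma Hplus_norm_ae_eq v w : measurable_fun lat v -> measurable_fun lat w ->
  ae_eq_lateral sigma T Gamma v w ->
  Hplus_norm sigma T Gamma v = Hplus_norm sigma T Gamma w.
Proof. by move=> mv mw vw; rewrite /Hplus_norm (Haniso_norm2_ae_eq mv mw vw). Qed.

Lemma Hplus_normZ v a : Hplus sigma T Gamma v ->
  Hplus_norm sigma T Gamma (fun z => a * v z) =
  `|a| * Hplus_norm sigma T Gamma v.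
Proof.
case=> mv v_fin; rewrite /Hplus_norm Haniso_norm2Z// fineM//; last first.
  by rewrite ge0_fin_numE// Haniso_norm2_ge0.
by rewrite sqrtrM ?sqr_ge0// sqrtr_sqr.
Qed.

Lemma HplusZ v a : Hplus sigma T Gamma v -> Hplus sigma T Gamma (fun z => a * v z).
Proof.
case=> mv v_fin; split.
  by apply: measurable_funM => //; exact: measurable_cst.
by rewrite Haniso_norm2Z// lte_mul_pinfty ?lee_fin ?sqr_ge0.
Qed.

Lemma Hplus_cst c : Hplus sigma T Gamma (cst c).
Proof.
split; first exact: measurable_cst.
rewrite Haniso_norm2_cst lte_mul_pinfty ?lee_fin ?mulrn_wge0 ?sqr_ge0//.
apply: lte_mul_pinfty => //.
  by rewrite ge0_fin_numE//= lebesgue_measure_itv/=; case: ifP => // _; rewrite -EFinB ltry.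
by rewrite ltey_eq fin_num_measure.
Qed.

End LateralNorm.
(** * Duality and the single-layer operator *)

Section Duality.
Context (R : realType) (n : nat)
  (sigma : {finite_measure set (Rn R n) -> \bar R}) (T : R)
  (Gamma : set (Rn R n)).
Hypothesis mGamma : measurable Gamma.

Local Notation Hp := (Hplus sigma T Gamma).
Local Notation Hm := (Hminus sigma T Gamma).
Local Notation normp := (Hplus_norm sigma T Gamma).
Local Notation normm := (Hminus_norm sigma T Gamma).
Implicit Types (v w : ST R n -> R) (psi chi : (ST R n -> R) -> R).

Lemma Hplus0 : Hp (cst 0). Proof. exact: Hplus_cst. Qed.

Lemma Hplus_norm0 : normp (cst 0) = 0.
Proof.
by rewrite /Hplus_norm Haniso_norm2_cst// expr0n mul0rn mul0e fine0 sqrtr0.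
Qed.

Lemma Hminus0E psi : Hm psi -> psi (cst 0) = 0.
Proof.
case=> _ lin _; have := lin 1 _ _ Hplus0 Hplus0.
rewrite (_ : (fun z => _) = cst 0); last by apply/funext => z /=; rewrite mulr0 addr0.
by rewrite mul1r => /eqP; rewrite -subr_eq subrr => /eqP <-.
Qed.

Lemma HminusZE psi a v : Hm psi -> Hp v -> psi (fun z => a * v z) = a * psi v.
Proof.
move=> psim vp; have [_ lin _] := psim; have := lin a _ _ vp Hplus0.
rewrite Hminus0E// addr0 => <-; congr psi.
by apply/funext => z; rewrite addr0.
Qed.

Lemma HminusBE psi v w : Hm psi -> Hp v -> Hp w -> psi (v \- w) = psi v - psi w.
Proof.
move=> [_ lin _] vp wp; have := lin (-1) _ _ wp vp.
rewrite mulN1r addrC => <-; congr psi.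
by apply/funext => z /=; rewrite mulN1r addrC.
Qed.

(** If [v] has positive norm, its normalisation competes in the supremum, which is finite by the
    bound contained in [Hminus]. If [v] has norm zero, that same bound forces [psi v = 0]. *)
Lemma Hminus_bound psi v : Hm psi -> Hp v -> `|psi v| <= normm psi * normp v.
Proof.
move=> psim vp; have [_ _ [C psiC]] := psim.
have [v0|v0] := eqVneq (normp v) 0.
  by rewrite v0 mulr0; have := psiC _ vp; rewrite v0 mulr0.
have vgt0 : 0 < normp v by rewrite lt_neqAle eq_sym v0 Hplus_norm_ge0.
rewrite -ler_pdivrMr//; apply: ub_le_sup.
  exists `|C| => _ [w [wp w1] <-]; apply: (le_trans (psiC _ wp)).
  rewrite (le_trans (ler_norm _))// normrM (ger0_norm (Hplus_norm_ge0 _ _ _ _)).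
  by rewrite ler_piMr.
exists (fun z => (normp v)^-1 * v z).
  split; first exact: HplusZ.
  by rewrite Hplus_normZ// ger0_norm ?invr_ge0 ?Hplus_norm_ge0// mulVf.
by rewrite HminusZE// normrM ger0_norm ?invr_ge0 ?Hplus_norm_ge0// mulrC.
Qed.

Lemma Hminus_norm_ge0 psi : 0 <= normm psi.
Proof.
rewrite /Hminus_norm; set S := [set _ | _ in _].
(* A set that is empty or unbounded above has [sup] equal to the default value [0]. *)
have [[[x Sx] ubS]|/sup_out-> //] := pselect (has_sup S).
by apply: le_trans (ub_le_sup ubS Sx); case: Sx => w _ <-.
Qed.

Lemma Hminus_comb a psi chi : Hm psi -> Hm chi ->
  Hm (fun v => a * psi v + chi v).
Proof.
move=> [psi0 psilin [C psiC]] [chi0 chilin [D chiD]]; split.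
- by move=> v nv; rewrite psi0// chi0// mulr0 addr0.
- move=> b v w vp wp; rewrite psilin// chilin// mulrDr mulrDr addrACA.
  by rewrite mulrCA.
- exists (`|a| * C + D) => v vp; rewrite (le_trans (ler_normD _ _))//.
  by rewrite mulrDl lerD ?chiD// normrM -mulrA ler_wpM2l ?psiC.
Qed.

Lemma Hminus0 : Hm (cst 0).
Proof.
split=> //; first by move=> a v w _ _ /=; rewrite mulr0 addr0.
by exists 0 => v _; rewrite normr0 mul0r.
Qed.

Lemma HminusZ a psi : Hm psi -> Hm (fun v => a * psi v).
Proof.
move=> psim; have := Hminus_comb a psim Hminus0.
by congr Hm; apply/funext => v; rewrite addr0.
Qed.

Lemma HminusB psi chi : Hm psi -> Hm chi -> Hm (psi \- chi).
Proof.
move=> psim chim; have := Hminus_comb (-1) chim psim.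
by congr Hm; apply/funext => v; rewrite mulN1r addrC.
Qed.

Lemma fin_dim_subspace_Hminus (X : set ((ST R n -> R) -> R)) :
  fin_dim_subspace sigma T Gamma X -> X `<=` Hm.
Proof.
move=> [d [b [bm ->]]] _ [c ->]; elim: (index_enum _) => [|i s IHs].
  rewrite (_ : (fun v => _) = cst 0); first exact: Hminus0.
  by apply/funext => v; rewrite big_nil.
have := Hminus_comb (c i) (bm i) IHs; congr Hm.
by apply/funext => v; rewrite big_cons.
Qed.

Lemma Hminus_normZ_le a psi : Hm psi -> normm (fun v => a * psi v) <= `|a| * normm psi.
Proof.
move=> psim; apply: ge_sup.
  by exists `|a * psi (cst 0)|, (cst 0) => //; split; [exact: Hplus0|rewrite Hplus_norm0].
move=> _ [w [wp w1] <-]; rewrite normrM ler_wpM2l//.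
by rewrite (le_trans (Hminus_bound psim wp))// ler_piMr// Hminus_norm_ge0.
Qed.

Section SingleLayer.
Variables (V : ((ST R n -> R) -> R) -> (ST R n -> R)).
Hypothesis hV : single_layer sigma T Gamma V.

Local Notation "v =lat w" := (ae_eq_lateral sigma T Gamma v w) (at level 70).

Lemma single_layer0 : V (cst 0) =lat cst 0.
Proof.
have := single_layer_linear hV 1 Hminus0 Hminus0.
rewrite (_ : (fun v => _) = cst 0); last first.
  by apply/funext => v /=; rewrite mulr0 addr0.
apply: filterS => z + lz => /(_ lz); rewrite mul1r => /eqP.
by rewrite -subr_eq subrr => /eqP <-.
Qed.

Lemma single_layerZ a psi : Hm psi ->
  V (fun v => a * psi v) =lat (fun z => a * V psi z).
Proof.
move=> psim; have := single_layer_linear hV a psim Hminus0.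
rewrite (_ : (fun v => _) = (fun v => a * psi v)); last first.
  by apply/funext => v /=; rewrite addr0.
move: single_layer0; apply: filterS2 => z V0 + lz => /(_ lz) ->.
by rewrite V0// addr0.
Qed.

(** Normalisation as in [Hminus_bound]. Scaling passes through [V] only up to equality almost
    everywhere, which the norm does not see. *)
Lemma single_layer_norm_bound psi : Hm psi ->
  normp (V psi) <= single_layer_norm sigma T Gamma V * normm psi.
Proof.
move=> psim; have [C VC] := single_layer_bounded hV.
have [psi0|psi0] := eqVneq (normm psi) 0.
  by rewrite psi0 mulr0; have := VC _ psim; rewrite psi0 mulr0.
have psi_gt0 : 0 < normm psi by rewrite lt_neqAle eq_sym psi0 Hminus_norm_ge0.
have Vpsi := single_layer_Hplus hV psim.
rewrite -ler_pdivrMr//; apply: ub_le_sup.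
  exists `|C| => _ [chi [chim chi1] <-]; apply: (le_trans (VC _ chim)).
  rewrite (le_trans (ler_norm _))// normrM (ger0_norm (Hminus_norm_ge0 _)).
  by rewrite ler_piMr.
exists (fun v => (normm psi)^-1 * psi v).
  split; first exact: HminusZ.
  rewrite (le_trans (Hminus_normZ_le _ psim))//.
  by rewrite ger0_norm ?invr_ge0 ?Hminus_norm_ge0// mulVf.
have aZ := single_layerZ (normm psi)^-1 psim.
rewrite (Hplus_norm_ae_eq mGamma _ _ aZ); last 2 first.
- exact: (single_layer_Hplus hV (HminusZ _ psim)).1.
- by have [] := HplusZ mGamma (normm psi)^-1 Vpsi.
by rewrite Hplus_normZ// ger0_norm ?invr_ge0 ?Hminus_norm_ge0// mulrC.
Qed.

(** With [N = normm psi], coercivity and duality give [c * N ^+ 2 <= N * normp (V psi)], and a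
    positive [N] cancels. *)
Lemma coercive_norm_bound c psi : coercive_with sigma T Gamma V c -> Hm psi ->
  normm psi <= c^-1 * normp (V psi).
Proof.
move=> [c0 hc] psim.
have [->|psi0] := eqVneq (normm psi) 0.
  by rewrite mulr_ge0 ?invr_ge0 ?Hplus_norm_ge0 ?ltW.
have psi_gt0 : 0 < normm psi by rewrite lt_neqAle eq_sym psi0 Hminus_norm_ge0.
rewrite ler_pdivlMl// -(ler_pM2r psi_gt0) -mulrA -expr2 (le_trans (hc _ psim))//.
rewrite (le_trans (ler_norm _))// mulrC.
exact: Hminus_bound (single_layer_Hplus hV psim).
Qed.

(** A preimage of the constant [1] exists by surjectivity; since that constant has positive norm,
    the operator norm cannot vanish. This is what makes [Ceff] positive, hence invertible. *)
Lemma single_layer_norm_gt0 :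
  0 < T -> (0 < sigma Gamma)%E -> 0 < single_layer_norm sigma T Gamma V.
Proof.
move=> T0 sG; have [psi psim psi1] := single_layer_surj hV (Hplus_cst sigma T mGamma 1).
have := single_layer_norm_bound psim.
rewrite (Hplus_norm_ae_eq mGamma _ _ psi1); last 2 first.
- exact: (single_layer_Hplus hV psim).1.
- exact: measurable_cst.
move=> h; have : 0 < single_layer_norm sigma T Gamma V * normm psi.
  apply: lt_le_trans h; rewrite /Hplus_norm Haniso_norm2_cst// sqrtr_gt0.
  have := Hplus_cst sigma T mGamma 1 => -[_]; rewrite Haniso_norm2_cst// => fin1.
  rewrite fine_gt0// fin1 andbT expr1n mule_gt0 ?lte_fin//.
  by rewrite mule_gt0// lebesgue_measure_itv/= lte_fin T0 -EFinB lte_fin subr0.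
have := Hminus_norm_ge0 psi; rewrite le_eqVlt => /predU1P[<-|psi0].
  by rewrite mulr0 ltxx.
by rewrite pmulr_lgt0.
Qed.

Section Residual.
Variables (f : ST R n -> R) (phi Phi : (ST R n -> R) -> R).
Hypotheses (fp : Hp f) (phim : Hm phi) (Vphi : V phi =lat f) (Phim : Hm Phi).

Lemma residual_ae : V (phi \- Phi) =lat (f \- V Phi).
Proof.
have := single_layer_linear hV (-1) Phim phim.
rewrite (_ : (fun v => _) = phi \- Phi); last first.
  by apply/funext => v /=; rewrite mulN1r addrC.
move: Vphi; apply: filterS2 => z Vz + lz => /(_ lz) ->.
by rewrite Vz//= mulN1r addrC.
Qed.

(** Finiteness of the norm is read off from [V (phi \- Phi)], which lies in [Hplus] and equals the
    residual almost everywhere; no triangle inequality enters. *)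
Lemma residual_Hplus : Hp (f \- V Phi).
Proof.
have VPhip := single_layer_Hplus hV Phim.
have mres : measurable_fun (lateral T Gamma) (f \- V Phi).
  by apply: measurable_funB; [exact: fp.1|exact: VPhip.1].
have Vp := single_layer_Hplus hV (HminusB phim Phim).
split => //; rewrite -(Haniso_norm2_ae_eq mGamma Vp.1 mres residual_ae).
exact: Vp.2.
Qed.

Lemma residual_norm : normp (f \- V Phi) = normp (V (phi \- Phi)).
Proof.
apply/esym; apply: Hplus_norm_ae_eq => //; last exact: residual_ae.
- exact: (single_layer_Hplus hV (HminusB phim Phim)).1.
- exact: residual_Hplus.1.
Qed.

End Residual.

End SingleLayer.

End Duality.
(** * Geometry of prisms *)

Section EuclideanNorm.
Context (R : realType) (n : nat).
Implicit Types x y : 'rV[R]_n.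

Lemma dotpE x : dotp x x = \sum_i x 0 i ^+ 2.
Proof. by apply: eq_bigr => i _; rewrite expr2. Qed.

Lemma coord_le_norm x i : `|x 0 i| <= `|x|.
Proof.
by rewrite [leRHS]/Num.norm/= mx_normrE (le_bigmax _ (fun ij => `|x ij.1 ij.2|) (0, i)).
Qed.

(** Together with [enorm_le_norm], it moves boundedness and continuity between the sup norm of the
    topology and the Euclidean norm of the mesh definitions. *)
Lemma norm_le_enorm x : `|x| <= enorm x.
Proof.
rewrite [leLHS]/Num.norm/= mx_normrE; apply: bigmax_le; first exact: sqrtr_ge0.
move=> [i j] _ /=; rewrite ord1 -sqrtr_sqr ler_wsqrtr// dotpE.
by rewrite (bigD1 j)//= lerDl sumr_ge0// => k _; exact: sqr_ge0.
Qed.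

Lemma enorm_le_norm x : enorm x <= n%:R * `|x|.
Proof.
rewrite -(ger0_norm (_ : 0 <= n%:R * `|x|)) ?mulr_ge0//.
rewrite -sqrtr_sqr ler_wsqrtr// dotpE exprMn.
apply: (@le_trans _ _ (\sum_(i < n) `|x| ^+ 2)).
  by apply: ler_sum => i _; rewrite -real_normK ?num_real// lerXn2r ?nnegrE// coord_le_norm.
rewrite sumr_const card_ord -[leLHS]mulr_natl ler_wpM2r ?sqr_ge0// -natrX ler_nat.
by case: n => // m; rewrite -mulnn leq_pmulr.
Qed.

Lemma eudist_gt0 x y : x != y -> 0 < eudist x y.
Proof.
rewrite -subr_eq0 -normr_gt0 => xy; exact: lt_le_trans xy (norm_le_enorm _).
Qed.

Lemma has_sup_diam (A : set 'rV[R]_n) : A !=set0 -> bounded_set A ->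
  has_sup [set eudist x y | x in A & y in A].
Proof.
move=> [x Ax] /pinfty_ex_gt0[M M0 AM]; split; first by exists (eudist x x), x => //; exists x.
exists (n%:R * (M + M)) => _ [a Aa [b Ab <-]].
rewrite (le_trans (enorm_le_norm _))// ler_wpM2l// (le_trans (ler_normB _ _))//.
by rewrite lerD//; exact: AM.
Qed.

Lemma eudist_le_diam (A : set 'rV[R]_n) x y : bounded_set A ->
  A x -> A y -> eudist x y <= diam A.
Proof.
move=> bA Ax Ay; apply: ub_le_sup; last by exists x => //; exists y.
by have [] := has_sup_diam (ex_intro _ x Ax) bA.
Qed.

Lemma diam_ge0 (A : set 'rV[R]_n) : 0 <= diam A.
Proof.
rewrite /diam; set S := [set _ | _ in _ & _ in _].
have [[[d Sd] ubS]|/sup_out-> //] := pselect (has_sup S).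
by apply: le_trans (ub_le_sup ubS Sd); case: Sd => x _ [y _ <-]; exact: eudist_ge0.
Qed.

End EuclideanNorm.

Lemma compact_lipschitz_domain_compact (R : realType) (n : nat)
    (A : set 'rV[R]_n) : compact_lipschitz_domain A -> compact A.
Proof.
move=> [D [_ [M DM] ->]]; apply: bounded_closed_compact; last exact: closed_closure.
have DB : D `<=` [set x : 'rV[R]_n | `|x| <= M].
  by move=> x /DM; exact: le_trans (norm_le_enorm x).
exists M; split=> [|r Mr x Dx]; first exact: num_real.
apply: (le_trans _ (ltW Mr)).
suff : [set y : 'rV[R]_n | `|y| <= M] x by [].
have /closure_id -> : closed [set x : 'rV[R]_n | `|x| <= M].
  apply: (@closed_comp _ _ (fun x : 'rV[R]_n => `|x|) [set r | r <= M]).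
    by move=> y _; exact: norm_continuous.
  exact: closed_le.
exact: closure_subset DB _ Dx.
Qed.

(** Balls are those of the sup norm, so a small shift by [e / 2] in every coordinate stays inside.
    In dimension zero there is no second point. The two points serve to show that prisms have
    positive diameter. *)
Lemma open_two_points (R : realType) (m : nat) (D : set 'rV[R]_m) :
  (0 < m)%N -> open D -> D !=set0 -> exists x y, [/\ D x, D y & x != y].
Proof.
case: m D => // m D _ oD [x Dx]; have /nbhs_ballP[e /= e0 xe] : nbhs x D by exact: open_nbhs_nbhs.
exists x, (x + const_mx (e / 2)); split => //.
  apply: xe; rewrite -ball_normE/= opprD addNKr normrN.
  rewrite [ltLHS]/Num.norm/= mx_normrE.
  apply: bigmax_lt => // -[i j] _ /=; rewrite mxE gtr0_norm ?divr_gt0//.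
  by rewrite ltr_pdivrMr// ltr_pMr// ltr1n.
rewrite -subr_eq0 opprD addNKr oppr_eq0; apply/eqP => /matrixP/(_ 0 0).
by rewrite !mxE => /eqP; rewrite mulf_eq0 invr_eq0 pnatr_eq0 orbF gt_eqF.
Qed.

Lemma bi_lipschitz_image_compact (R : realType) (m n : nat) (A : set 'rV[R]_m)
    (chi : 'rV[R]_m -> 'rV[R]_n) :
  compact A -> bi_lipschitz_on A chi -> compact (chi @` A).
Proof.
move=> cA [L L0 chiL]; apply: continuous_compact => //.
apply/subspace_continuousP => x Ax; apply/cvgrPdist_lt => e e0.
(* [m.+1] in place of [m] keeps the constant positive also for [m = 0]. *)
have C0 : 0 < L * m.+1%:R by rewrite mulr_gt0.
have : \forall y \near x, `|x - y| < e / (L * m.+1%:R).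
  by apply/nbhs_ballP; exists (e / (L * m.+1%:R)) => /=;
    [rewrite divr_gt0|rewrite -ball_normE].
rewrite /prop_near1 /within/=; apply: filterS => y xy Ay.
rewrite (le_lt_trans (norm_le_enorm _))//.
have /andP[_ h] := chiL _ _ Ax Ay; apply: (le_lt_trans h).
apply: (@le_lt_trans _ _ (L * (m.+1%:R * `|x - y|))).
  rewrite ler_pM2l// (le_trans (enorm_le_norm _))// ler_wpM2r//.
  by rewrite ler_nat.
by rewrite mulrA mulrC -ltr_pdivlMr.
Qed.

Section PrismGeometry.
Context (R : realType) (n : nat) (T : R) (Gamma : set (Rn R n)).
Implicit Types p : prism R n.

Lemma prism_compact p : is_prism T Gamma p -> compact (p.2 : set 'rV[R]_n).
Proof.
move=> [_ [_ [A [chi [/compact_lipschitz_domain_compact cA lip ->]]]]].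
exact: bi_lipschitz_image_compact.
Qed.

Lemma prism_measurable2 p : is_prism T Gamma p -> measurable p.2.
Proof.
move=> /prism_compact cp; apply: (closed_measurable_Rn (A := p.2)).
by apply: compact_closed cp; exact: norm_hausdorff.
Qed.

Lemma prism_measurable1 p : is_prism T Gamma p ->
  measurable (p.1 : set (measurableTypeR R)).
Proof. by move=> [[a [b [_ -> _]]] _]; exact: measurable_itv. Qed.

Lemma prism_neq01 p : is_prism T Gamma p -> p.1 !=set0.
Proof.
by move=> [[a [b [ab -> _]]] _]; exists a; rewrite /= in_itv/= lexx ab.
Qed.

Lemma prism_neq02 p : is_prism T Gamma p -> p.2 !=set0.
Proof.
move=> [_ [_ [A [chi [[D [[_ _ [x Dx] _ _] _ ->]] _ ->]]]]].
by exists (chi x), x => //; exact: subset_closure.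
Qed.

Lemma prism_sub1 p : is_prism T Gamma p -> p.1 `<=` `[0, T]%classic.
Proof. by move=> [[a [b []]]]. Qed.

Lemma prism_sub2 p : is_prism T Gamma p -> p.2 `<=` Gamma.
Proof. by move=> [_ []]. Qed.

Lemma prism_eudist_le_diam p (x y : Rn R n) : is_prism T Gamma p ->
  p.2 x -> p.2 y -> eudist (x : 'rV[R]_n) y <= diam p.2.
Proof. by move=> /prism_compact/compact_bounded; exact: eudist_le_diam. Qed.

(** The lower bi-Lipschitz bound keeps the images of two distinct parameter points apart; [1 < n]
    makes the parameter domain at least one-dimensional. *)
Lemma prism_diam_gt0 p : (1 < n)%N -> is_prism T Gamma p -> 0 < diam p.2.
Proof.
move=> n1 pp; have pdiam := prism_eudist_le_diam pp; move: pp pdiam.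
move=> [_ [_ [A [chi [[D [[oD _ D0 _ _] _ ->]] [L L0 chiL] ->]]]]] pdiam.
have : exists x y, [/\ D x, D y & x != y].
  by apply: (open_two_points _ oD D0); rewrite -ltnS prednK// ltnW.
move=> [x [y [Dx Dy xy]]].
have [cx cy] : closure D x /\ closure D y by split; exact: subset_closure.
have /andP[h _] := chiL _ _ cx cy.
apply: (lt_le_trans _ (pdiam (chi x) (chi y) _ _)); last 2 first.
- by exists x.
- by exists y.
by apply: lt_le_trans h; rewrite mulr_gt0 ?invr_gt0 ?eudist_gt0.
Qed.

End PrismGeometry.
(** * Finite overlap and efficiency *)

Section Counting.

Lemma leq_card_fset_set_inj (I J : choiceType) (A : set I) (B : set J)
    (f : I -> J) : finite_set A -> finite_set B -> set_inj A f ->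
  f @` A `<=` B -> (#|` fset_set A| <= #|` fset_set B|)%N.
Proof.
move=> fA fB injf AB.
have -> : #|` fset_set A| = #|` [fset f x | x in fset_set A]%fset|.
  apply/esym; rewrite card_in_imfset// => x y.
  by rewrite !in_fset_set// => xA yA; exact: injf.
apply: fsubset_leq_card; rewrite -fset_set_image// -fset_set_sub//.
exact: finite_image.
Qed.

(** Source of the factor 4 in time: neighbours are encoded by two bits in
    [card_touching_intervals]. *)
Lemma card_fset_set_pair_bool (I : choiceType) (A : set I)
    (f : I -> bool * bool) : finite_set A -> set_inj A f ->
  (#|` fset_set A| <= 4)%N.
Proof.
move=> fA injf.
have -> : #|` fset_set A| = #|` [fset f x | x in fset_set A]%fset|.
  apply/esym; rewrite card_in_imfset// => x y.
  by rewrite !in_fset_set// => xA yA; exact: injf.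
apply: (leq_trans (n := #|` [fset x | x in enum {: bool * bool}]%fset|)).
  by apply: fsubset_leq_card; apply/fsubsetP => x _; rewrite !inE mem_enum.
by rewrite card_fseq undup_id ?enum_uniq// -cardE card_prod card_bool.
Qed.

Lemma fsume_cst (R : realType) (I : choiceType) (A : set I) (c : \bar R) :
  finite_set A -> (0 <= c)%E ->
  (\sum_(i \in A) c = (#|` fset_set A|)%:R%:E * c)%E.
Proof.
move=> fA c0; rewrite fsbig_finite// big_const_seq count_predT.
elim: (size _) => [|k IHk]; first by rewrite mul0e.
by rewrite iterS IHk -natr1 EFinD ge0_muleDl// mul1e addeC.
Qed.

Lemma ae_finite_set d (X : measurableType d) (R : realType)
    (mu : {measure set X -> \bar R}) (I : choiceType) (A : set I)
    (Q : I -> X -> Prop) : finite_set A ->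
  (forall i, A i -> {ae mu, forall x, Q i x}) ->
  {ae mu, forall x, forall i, A i -> Q i x}.
Proof.
move=> fA AQ.
have : (\forall x \near almost_everywhere mu,
    (\bigcap_(i in [set` fset_set A]) [set x | Q i x]) x).
  by apply: filter_bigI => i; rewrite in_fset_set// inE; exact: AQ.
by apply: filterS => x + i Ai; apply; rewrite /= in_fset_set// inE.
Qed.

(** There are finitely many pairs, and every intersection of measure zero can itself be put into the
    exceptional set. At a generic point, sharing the point thus becomes genuine overlap. *)
Lemma ae_measure_gt0 d (X : measurableType d) (R : realType)
    (mu : {measure set X -> \bar R}) (I : choiceType) (A : set I)
    (F : I -> set X) : finite_set A -> (forall i, A i -> measurable (F i)) ->
  {ae mu, forall x, forall i j, A i -> A j -> (F i `&` F j) x ->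
    (0 < mu (F i `&` F j))%E}.
Proof.
move=> fA mF.
suff : {ae mu, forall x, forall i, A i -> forall j, A j -> (F i `&` F j) x ->
    (0 < mu (F i `&` F j))%E}.
  by apply: filterS => x h i j Ai Aj; exact: h.
apply: ae_finite_set => // i Ai; apply: ae_finite_set => // j Aj.
have [e0|ne0] := eqVneq (mu (F i `&` F j)) 0%E; last first.
  by apply: aeW => x _; rewrite lt_neqAle eq_sym ne0 measure_ge0.
exists (F i `&` F j); split => //; first by apply: measurableI; exact: mF.
by move=> x /= /not_implyP[].
Qed.

(** Pull the double sum inside the integral. At almost every [x] at most one [i] has [x] in [D i],
    so only that row of the sum survives, and it counts [G x] once for each [j] with [x] in [A i j],
    hence at most [c] times. *)
Lemma weighted_overlap_bound d (X : measurableType d) (R : realType)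
    (mu : {measure set X -> \bar R}) (I : choiceType) (P : set I)
    (N : I -> set I) (D : I -> set X) (A : I -> I -> set X) (S : set X)
    (c : R) (G : X -> \bar R) :
  finite_set P -> (forall i, N i `<=` P) -> 0 <= c ->
  measurable S -> measurable_fun setT G -> (forall x, (0 <= G x)%E) ->
  (forall i j, P i -> P j -> measurable (A i j)) ->
  (forall i j, P i -> N i j -> A i j `<=` D i) ->
  {ae mu, forall x i, P i -> D i x -> S x} ->
  {ae mu, forall x i j, P i -> P j -> D i x -> D j x -> i = j} ->
  {ae mu, forall x i, P i -> D i x ->
    (#|` fset_set [set j | N i j /\ A i j x]|)%:R <= c} ->
  (\sum_(i \in P) \sum_(j \in N i) \int[mu]_(x in A i j) G x <=
    c%:E * \int[mu]_(x in S) G x)%E.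
Proof.
move=> fP NP c0 mS mG G0 mA AD aeS aeD aeN.
have fN i : finite_set (N i) by exact: sub_finite_set fP.
(* Measurability of [A i j] is known for indices in [P] only; the guard makes [g i j] measurable for
   all indices. *)
pose g i j := if `[< P i /\ P j >] then G \_ (A i j) else cst 0%E.
have mg i j : measurable_fun setT (g i j).
  rewrite /g; case: asboolP => [[Pi Pj]|_]; last exact: measurable_cst.
  by apply: (measurable_restrictT G (mA _ _ Pi Pj)).1; exact: measurable_funTS.
have g0 i j x : (0 <= g i j x)%E.
  by rewrite /g; case: asboolP => // _; exact: erestrict_ge0.
have gE i j x : P i -> N i j -> g i j x = if x \in A i j then G x else 0%E.
  by move=> Pi /NP Pj; rewrite /g asboolT// patchE.
have ge0N i x : (0 <= \sum_(j \in N i) g i j x)%E.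
  by rewrite fsbig_finite//; apply: sume_ge0 => j _; exact: g0.
have mN i : measurable_fun setT (fun x => \sum_(j \in N i) g i j x)%E.
  rewrite (_ : (fun x => _) = (fun x => \sum_(j <- fset_set (N i)) g i j x)%E).
    by apply: emeasurable_sum => j; exact: mg.
  by apply/funext => x; rewrite fsbig_finite.
have -> : (\sum_(i \in P) \sum_(j \in N i) \int[mu]_(x in A i j) G x =
    \int[mu]_x \sum_(i \in P) \sum_(j \in N i) g i j x)%E.
  rewrite ge0_integral_fsum//; apply: eq_fsbigr => i /[!inE] Pi.
  rewrite ge0_integral_fsum//; apply: eq_fsbigr => j /[!inE] Nij.
  by rewrite integral_mkcond; apply: eq_integral => x _; rewrite gE// patchE.
rewrite -ge0_integralZl//; last exact: measurable_funTS.
rewrite [leRHS]integral_mkcond; apply: ae_ge0_le_integral => //.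
- by move=> x _; rewrite fsbig_finite//; apply: sume_ge0 => i _; exact: ge0N.
- rewrite (_ : (fun x => _) =
      (fun x => \sum_(i <- fset_set P) \sum_(j \in N i) g i j x)%E).
    by apply: emeasurable_sum => i; exact: mN.
  by apply/funext => x; rewrite fsbig_finite.
- by move=> x _; apply: erestrict_ge0 => y _; rewrite mule_ge0.
- apply: (measurable_restrictT _ mS).1; apply: measurable_funTS.
  by apply: emeasurable_funM => //; exact: measurable_cst.
move: aeS aeD aeN; apply: filterS3 => x xS xD xN _.
(* Either no [D i] contains [x] and every term vanishes, or the row of a single [i0] remains. *)
have [[i0 [Pi0 Di0]]|nD] := pselect (exists i, P i /\ D i x); last first.
  rewrite fsbig1; first by apply: erestrict_ge0 => y _; rewrite mule_ge0.
  move=> i Pi; apply: fsbig1 => j Nij; rewrite gE//; case: ifPn => // /[!inE].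
  by move=> /(AD _ _ Pi Nij) Di; case: nD; exists i.
rewrite (fsbigD1 i0)//= [X in (_ + X)%E]fsbig1 ?adde0; last first.
  move=> i [Pi /= ii0]; apply: fsbig1 => j Nij; rewrite gE//.
  case: ifPn => // /[!inE] /(AD _ _ Pi Nij) Di; case: ii0; exact: (xD i i0).
rewrite patchE mem_set; last exact: xS Di0.
have -> : (\sum_(j \in N i0) g i0 j x =
    \sum_(j \in N i0 `&` [set j | A i0 j x]) G x)%E.
  rewrite fsbig_mkcondr; apply: eq_fsbigr => j /[!inE] Nj.
  by rewrite gE//; congr (if _ then _ else _); apply/idP/idP; rewrite !inE.
rewrite fsume_cst//; last by apply: sub_finite_set fP => j [/NP].
by rewrite lee_wpmul2r// lee_fin xN.
Qed.

End Counting.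
Lemma le_integral_setU d (X : measurableType d) (R : realType)
    (mu : {measure set X -> \bar R}) (A B : set X) (f : X -> \bar R) :
  measurable A -> measurable B -> measurable_fun setT f ->
  (forall x, (0 <= f x)%E) ->
  (\int[mu]_(x in A `|` B) f x <=
    \int[mu]_(x in A) f x + \int[mu]_(x in B) f x)%E.
Proof.
move=> mA mB mf f0; have -> : A `|` B = A `|` (B `\` A).
  apply/seteqP; split => x [Ax|Bx]; [by left| |by left|by right; case: Bx].
  by have [Ax|nAx] := pselect (A x); [left|right].
have mBA : measurable (B `\` A) by exact: measurableD.
rewrite ge0_integral_setU//; last 2 first.
- exact: measurable_funTS.
- by apply/disj_setPS => x [Ax []].
rewrite leeD2l//; apply: ge0_subset_integral => //; exact: measurable_funTS.
Qed.

Lemma fsume_swap (R : realType) (I : choiceType) (P : set I)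
    (N : I -> set I) (F : I -> I -> \bar R) :
  finite_set P -> (forall i, N i `<=` P) ->
  (forall i j, P i -> N i j -> N j i) -> (forall i j, (0 <= F i j)%E) ->
  (\sum_(i \in P) \sum_(j \in N i) F j i =
   \sum_(i \in P) \sum_(j \in N i) F i j)%E.
Proof.
move=> fP NP Nsym F0.
have NE (f : I -> I -> \bar R) i : (\sum_(j \in N i) f i j =
    \sum_(j \in P) if j \in N i then f i j else 0)%E.
  by rewrite -fsbig_mkcondr setIidr.
under eq_fsbigr do rewrite (NE (fun i j => F j i)).
under [RHS]eq_fsbigr do rewrite NE.
rewrite exchange_fsbig//; apply: eq_fsbigr => i /[!inE] Pi.
apply: eq_fsbigr => j /[!inE] Pj; congr (if _ then _ else _).
by apply/idP/idP; rewrite !inE; exact: Nsym.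
Qed.

(** Origin of the factor 2: the seminorm attached to a pair splits into an integral over a piece of
    each of the two prisms, and for a symmetric relation the two resulting double sums coincide. *)
Lemma fsume_le_sym (R : realType) (I : choiceType) (P : set I)
    (N : I -> set I) (F G : I -> I -> \bar R) :
  finite_set P -> (forall i, N i `<=` P) ->
  (forall i j, P i -> N i j -> N j i) -> (forall i j, (0 <= G i j)%E) ->
  (forall i j, P i -> P j -> F i j <= G i j + G j i)%E ->
  (\sum_(i \in P) \sum_(j \in N i) F i j <=
   \sum_(i \in P) \sum_(j \in N i) G i j +
   \sum_(i \in P) \sum_(j \in N i) G i j)%E.
Proof.
move=> fP NP Nsym G0 FG; have fN i : finite_set (N i) by exact: sub_finite_set fP.
rewrite -[X in (_ <= _ + X)%E](fsume_swap fP NP Nsym G0) -fsbig_split//=.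
apply: lee_fsum => // i Pi; rewrite -fsbig_split//=.
by apply: lee_fsum => // j Nij; exact: FG (NP _ _ Nij).
Qed.

(** * Generic overlap and neighbour counts of a prismatic mesh *)

Section Mesh.
Context (R : realType) (n : nat)
  (sigma : {finite_measure set (Rn R n) -> \bar R}) (T : R)
  (Gamma : set (Rn R n)) (P : set (prism R n)).
Hypotheses (mGamma : measurable Gamma) (n1 : (1 < n)%N)
  (hP : prismatic_mesh sigma T Gamma P).

Local Notation mu := (@lebesgue_measure R).
Local Notation I := (`]0, T[%classic : set R).
Local Notation lat := (lateral T Gamma).
Implicit Types (p q : prism R n) (u v : ST R n -> R).

Let fP : finite_set P. Proof. by case: hP. Qed.

Lemma mesh_prism p : P p -> is_prism T Gamma p.
Proof. by case: hP => _ h _ _; exact: h. Qed.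

Let m1 p : P p -> measurable (p.1 : set (measurableTypeR R)).
Proof. by move=> /mesh_prism/prism_measurable1. Qed.

Let m2 p : P p -> measurable p.2.
Proof. by move=> /mesh_prism/prism_measurable2. Qed.

Let s1 p : P p -> p.1 `<=` `[0, T]%classic.
Proof. by move=> /mesh_prism/prism_sub1. Qed.

Let s2 p : P p -> p.2 `<=` Gamma.
Proof. by move=> /mesh_prism/prism_sub2. Qed.

(** Turns a mesh condition guaranteed at almost every time into a fact about one prism, provided its
    time interval has positive length. *)
Lemma ae_time_exists (Q : R -> Prop) (J : set R) : ae_time T Q ->
  measurable (J : set (measurableTypeR R)) -> J `<=` `[0, T]%classic ->
  (0 < mu J)%E -> exists2 t, J t & Q t.
Proof.
move=> [N [mN N0 QN]] mJ JT J0; apply: contrapT => /forall2NP nJ.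
have JN : J `<=` N.
  move=> t Jt; apply: QN => /= h; have [//|] := nJ t; apply; exact: h (JT _ Jt).
suff : (0 < 0 :> \bar R)%E by rewrite ltxx.
apply: (lt_le_trans J0); rewrite -[leRHS]N0.
by apply: le_measure => //; rewrite inE.
Qed.

Lemma mesh_at_time_prism p t : P p -> p.1 t -> mesh_at_time Gamma P t p.2.
Proof.
move=> Pp pt; have [x px] := prism_neq02 (mesh_prism Pp).
exists p.1; first by rewrite -surjective_pairing.
by exists (t, x); split => /=; split => //; exact: s2 Pp _ px.
Qed.

Lemma mesh_at_point_prism p x : P p -> p.2 x -> mesh_at_point T P x p.1.
Proof.
move=> Pp px; have [t pt] := prism_neq01 (mesh_prism Pp).
exists p.2; first by rewrite -surjective_pairing.
by exists (t, x); split => /=; split => //; exact: s1 Pp _ pt.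
Qed.

(** A prism of positive duration is seen at some admissible time. Were its surface part a null set,
    shape regularity would make the diameter vanish, against [prism_diam_gt0]. *)
Lemma mesh_shape C p : shape_const sigma T Gamma P C -> P p -> (0 < mu p.1)%E ->
  (0 < sigma p.2)%E /\ diam p.2 ^+ n.-1 <= C * fine (sigma p.2).
Proof.
move=> [C1 hC] Pp p0; have [t pt ht] := ae_time_exists hC (m1 Pp) (s1 Pp) p0.
have /andP[_ h] := ht _ (mesh_at_time_prism Pp pt); split => //.
rewrite lt_neqAle measure_ge0 andbT eq_sym; apply: contraTneq h => ->.
rewrite mulr0 -ltNge exprn_gt0//; exact: (prism_diam_gt0 n1 (mesh_prism Pp)).
Qed.

(** The intersection of two prisms is a product set, so its measure is the product of the two
    overlaps, and for distinct prisms it is zero. *)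
Lemma mesh_overlap p q : P p -> P q -> (0 < mu (p.1 `&` q.1))%E ->
  (0 < sigma (p.2 `&` q.2))%E -> p = q.
Proof.
case: hP => _ _ h _ Pp Pq pq1 pq2; apply: contrapT => npq.
have := h _ _ Pp Pq npq; rewrite -setXI product_measure1E; last 2 first.
- by apply: measurableI; exact: m1.
- by apply: measurableI; exact: m2.
by move=> h0; have := mule_gt0 pq1 pq2; rewrite h0 ltxx.
Qed.

Lemma ae_time_overlap : {ae mu, forall t, forall p q, P p -> P q ->
  (p.1 `&` q.1) t -> (0 < mu (p.1 `&` q.1))%E}.
Proof. exact: (ae_measure_gt0 mu fP (F := fun p => p.1)). Qed.

Lemma ae_point_overlap : {ae sigma, forall x, forall p q, P p -> P q ->
  (p.2 `&` q.2) x -> (0 < sigma (p.2 `&` q.2))%E}.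
Proof. exact: (ae_measure_gt0 sigma fP (F := fun p => p.2)). Qed.

Lemma ae_mesh_unique : {ae (mu \x sigma)%E, forall z, forall p q, P p -> P q ->
  (p.1 `*` p.2) z -> (q.1 `*` q.2) z -> p = q}.
Proof.
move: (ae_prod_fst sigma ae_time_overlap) (ae_prod_snd mu ae_point_overlap).
apply: filterS2 => z h1 h2 p q Pp Pq [pz1 pz2] [qz1 qz2].
by apply: mesh_overlap => //; [exact: h1|exact: h2].
Qed.

Lemma ae_mesh_lateral : {ae (mu \x sigma)%E, forall z, forall p, P p ->
  (p.1 `*` p.2) z -> lat z}.
Proof.
have : {ae mu, forall t : measurableTypeR R, t != 0 /\ t != T}.
  exists [set 0; T]; split.
  - by apply: measurableU; exact: measurable_set1.
  - by rewrite measureU0 //; by [exact: lebesgue_measure_set1|exact: measurable_set1].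
  - move=> t /= /not_andP[] /negP; rewrite negbK => /eqP; by [left|right].
move=> /(ae_prod_fst sigma); apply: filterS => z [t0 tT] p Pp [pz1 pz2].
split; last exact: s2 Pp _ pz2.
have := s1 Pp pz1; rewrite /= !in_itv/= !lt_neqAle => /andP[-> ->].
by rewrite eq_sym t0 tT.
Qed.

Lemma nei_xP p : nei_x P p `<=` P. Proof. by move=> q []. Qed.

Lemma nei_tP p : nei_t sigma P p `<=` P. Proof. by move=> q []. Qed.

Lemma nei_x_sym p q : P p -> nei_x P p q -> nei_x P q p.
Proof. by move=> Pp [Pq h1 h2]; split; rewrite // setIC. Qed.

Lemma nei_t_sym p q : P p -> nei_t sigma P p q -> nei_t sigma P q p.
Proof. by move=> Pp [Pq h1 h2]; split; rewrite // setIC. Qed.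

(** [Cnei] counts surface elements in a time slice, whereas [nei_x] counts prisms. At a generic time
    [snd] is injective on the prisms alive: two with the same surface part, which has positive
    measure by [mesh_shape], overlap in time as well and are equal. *)
Lemma ae_card_nei_x Cnei Cshape : nei_const T Gamma P Cnei ->
  shape_const sigma T Gamma P Cshape ->
  {ae mu, forall t : measurableTypeR R, forall p, P p -> p.1 t ->
    (#|` fset_set [set q | nei_x P p q /\ q.1 t]|)%:R <= Cnei}.
Proof.
rewrite /nei_const /ae_time => -[_ hnei] hshape.
apply: (filterS2 _ _ hnei ae_time_overlap) => t {}hnei hover p Pp pt.
apply: le_trans (hnei (s1 Pp pt) _ (mesh_at_time_prism Pp pt)); rewrite ler_nat.
apply: (leq_card_fset_set_inj (f := snd)).
- by apply: sub_finite_set fP => q [[]].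
- apply: (@sub_finite_set _ _ (snd @` P)); last exact: finite_image.
  by move=> K [[J PJK _] _]; exists (J, K).
- move=> q r /[!inE] -[[Pq _ _] qt] [[Pr _ _] rt] qr.
  have l0 := hover q r Pq Pr (conj qt rt); apply: mesh_overlap => //.
  rewrite qr setIid; apply: (mesh_shape hshape Pr _).1.
  by apply: lt_le_trans l0 _; rewrite le_measure ?inE//;
    [apply: measurableI; exact: m1|exact: m1].
- move=> K [q [[Pq _ pq] qt] <-]; split => //; exact: mesh_at_time_prism.
Qed.

Lemma len_gt0 p : P p -> (0 < len p.1) = (0 < mu p.1)%E.
Proof.
move=> /mesh_prism[[a [b [_ -> _]]] _].
rewrite /len lebesgue_measure_itv/= lte_fin; case: ifP => _; last by rewrite ltxx.
by rewrite -EFinB/= lte_fin.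
Qed.

Lemma prism_itv p : P p -> (0 < mu p.1)%E ->
  exists a b : R, a < b /\ p.1 = `[a, b]%classic.
Proof.
move=> /mesh_prism[[a [b [_ -> _]]] _] ab; exists a, b; split => //.
by move: ab; rewrite lebesgue_measure_itv/= lte_fin; case: ifP; rewrite ?ltxx.
Qed.

Lemma itvcc_overlap (a b c d e : R) : e < b -> e < d -> a <= e -> c <= e ->
  (0 < mu (`[a, b] `&` `[c, d])%classic)%E.
Proof.
move=> eb ed ae ce; apply: (@lt_le_trans _ _ (mu `[e, Num.min b d]%classic)).
  by rewrite lebesgue_measure_itv/= lte_fin lt_min eb ed/= -EFinB lte_fin subr_gt0 lt_min eb ed.
rewrite le_measure ?inE//; first by apply: measurableI; exact: measurable_itv.
move=> t; rewrite /= !in_itv/= le_min => /and3P[et -> ->].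
by rewrite !andbT (le_trans ae et) (le_trans ce et).
Qed.

(* Non-degenerate intervals meeting [a, b] with pairwise null intersections
   either are [a, b] itself or have [b] as left or [a] as right endpoint, so
   that [q |-> (a \in q, b \in q)] is injective on them. *)
Lemma card_touching_intervals (S : set (prism R n)) p : S `<=` P -> P p ->
  (forall q, S q -> (0 < mu q.1)%E /\ (p.1 `&` q.1) !=set0) ->
  (forall q r, S q -> S r -> (0 < mu (q.1 `&` r.1))%E -> q = r) ->
  (forall q, S q -> (0 < mu (p.1 `&` q.1))%E -> q = p) -> (0 < mu p.1)%E ->
  (#|` fset_set S| <= 4)%N.
Proof.
move=> SP Pp S0 Suniq Sp p0; have [a [b [ab pE]]] := prism_itv Pp p0.
have Sitv q : S q -> exists c d, [/\ c < d, q.1 = `[c, d]%classic &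
    [\/ q = p, d = a | c = b]].
  move=> Sq; have [q0 [t [pt qt]]] := S0 q Sq.
  have [c [d [cd qE]]] := prism_itv (SP _ Sq) q0; exists c, d; split => //.
  move: pt qt; rewrite pE qE /= !in_itv/= => /andP[a_t tb] /andP[ct td].
  have [da|ad] := leP d a.
    by constructor 2; apply/le_anti; rewrite da (le_trans a_t).
  have [bc|cb] := leP b c.
    by constructor 3; apply/le_anti; rewrite bc (le_trans ct).
  constructor 1; apply: Sp => //; rewrite pE qE.
  have [ac|ca] := leP a c.
    by apply: (itvcc_overlap cb cd) => //.
  by apply: (itvcc_overlap ab ad) => //; exact: ltW.
apply: (card_fset_set_pair_bool (f := fun q => (`[< q.1 a >], `[< q.1 b >]))).
  exact: sub_finite_set fP.
have aE q : S q -> q.1 a -> q.1 b -> q = p.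
  move=> Sq; have [c [d [cd -> [//| -> | ->]]]] := Sitv q Sq.
    by rewrite /= !in_itv/= [b <= a]leNgt ab/= andbF.
  by rewrite /= !in_itv/= [b <= a]leNgt ab.
have ad q : S q -> q.1 a -> ~ q.1 b -> exists2 c, c < a & q.1 = `[c, a]%classic.
  move=> Sq; have [c [d [cd qE [qp| da | cb]]]] := Sitv q Sq.
  - by move=> _ []; rewrite qp pE /= in_itv/= lexx ltW.
  - by rewrite qE da => _ _; exists c => //; rewrite -da.
  - by move=> _ []; rewrite qE cb /= in_itv/= lexx ltW// -cb.
have bc q : S q -> ~ q.1 a -> exists2 d, b < d & q.1 = `[b, d]%classic.
  move=> Sq; have [c [d [cd qE [qp| da | cb]]]] := Sitv q Sq.
  - by case; rewrite qp pE /= in_itv/= lexx ltW.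
  - by case; rewrite qE da /= in_itv/= lexx ltW// -da.
  - by rewrite qE cb => _; exists d => //; rewrite -cb.
(* Compare equal pairs of bits. Both set: each prism is [p]. Only the first set: both intervals end
   at [a] and overlap just below it. First bit unset: both start at [b] and overlap just above
   it. *)
move=> q r /[!inE] Sq Sr [].
have [qa|nqa] := pselect (q.1 a); have [ra|nra] := pselect (r.1 a);
  rewrite ?(asboolT qa) ?(asboolF nqa) ?(asboolT ra) ?(asboolF nra) // => _.
  have [qb|nqb] := pselect (q.1 b); have [rb|nrb] := pselect (r.1 b);
    rewrite ?(asboolT qb) ?(asboolF nqb) ?(asboolT rb) ?(asboolF nrb) // => _.
    by rewrite (aE q)// (aE r).
  have [c ca qE] := ad q Sq qa nqb; have [c' c'a rE] := ad r Sr ra nrb.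
  apply: Suniq => //; rewrite qE rE.
  have [cc'|c'c] := leP c c'; first exact: (itvcc_overlap c'a c'a).
  by apply: (itvcc_overlap ca ca) => //; exact: ltW.
have [d bd qE] := bc q Sq nqa; have [d' bd' rE] := bc r Sr nra.
by move=> _; apply: Suniq => //; rewrite qE rE; exact: (itvcc_overlap bd bd').
Qed.

(** Prisms over a generic [x] overlap in space, so by [mesh_overlap] distinct ones have null overlap
    in time. Quasi-uniformity passes positive length from [p] to its neighbours, as
    [card_touching_intervals] requires. *)
Lemma ae_card_nei_t Clqu : lqu_const sigma T Gamma P Clqu ->
  {ae sigma, forall x, forall p, P p -> p.2 x -> (0 < mu p.1)%E ->
    (#|` fset_set [set q | nei_t sigma P p q /\ q.2 x]|)%:R <= 4%:R :> R}.
Proof.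
rewrite /lqu_const /ae_point => -[C1 hlqu].
apply: (filterS2 _ _ hlqu ae_point_overlap) => x {}hlqu hover p Pp px p0.
rewrite ler_nat.
apply: (@card_touching_intervals _ p) => //.
- by move=> q [[]].
- move=> q [[Pq pq _] qx]; split => //.
  have := hlqu (s2 Pp px) _ _ (mesh_at_point_prism Pp px)
    (mesh_at_point_prism Pq qx) pq.
  rewrite -len_gt0//; move: p0; rewrite -len_gt0// => p0 /(lt_le_trans p0).
  by rewrite pmulr_rgt0// (lt_le_trans ltr01).
- by move=> q r [[Pq _ _] qx] [[Pr _ _] rx] qr; apply: mesh_overlap => //; exact: hover.
- move=> q [[Pq _ _] qx] qr; apply/esym; apply: mesh_overlap => //; exact: hover.
Qed.

End Mesh.

(** * Efficiency: the indicators bounded by the global norm *)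

Section EtaBound.
Context (R : realType) (n : nat)
  (sigma : {finite_measure set (Rn R n) -> \bar R}) (T : R)
  (Gamma : set (Rn R n)) (P : set (prism R n)).
Hypotheses (mGamma : measurable Gamma) (n1 : (1 < n)%N)
  (hP : prismatic_mesh sigma T Gamma P).

Local Notation mu := (@lebesgue_measure R).
Local Notation I := (`]0, T[%classic : set R).
Local Notation lat := (lateral T Gamma).
Implicit Types (p q : prism R n) (u v : ST R n -> R).

Let fP : finite_set P. Proof. by case: hP. Qed.

Let m1 p : P p -> measurable (p.1 : set (measurableTypeR R)).
Proof. by move=> /(mesh_prism hP)/prism_measurable1. Qed.

Let m2 p : P p -> measurable p.2.
Proof. by move=> /(mesh_prism hP)/prism_measurable2. Qed.

Let s1 p : P p -> p.1 `<=` `[0, T]%classic.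
Proof. by move=> /(mesh_prism hP)/prism_sub1. Qed.

Let s2 p : P p -> p.2 `<=` Gamma.
Proof. by move=> /(mesh_prism hP)/prism_sub2. Qed.

Lemma L2t_L2_prism_restr v p : measurable_fun lat v -> P p ->
  L2t_norm2 p.1 (L2_norm2 sigma p.2) v =
  L2t_norm2 p.1 (L2_norm2 sigma p.2) (restr_lateral T Gamma v).
Proof.
by move=> mv Pp; exact: (L2t_L2_restr sigma mGamma mv (m1 Pp) (s1 Pp) (m2 Pp) (s2 Pp)).
Qed.

Lemma eta_x2_restr v p : measurable_fun lat v -> P p ->
  eta_x2 sigma P v p = eta_x2 sigma P (restr_lateral T Gamma v) p.
Proof.
move=> mv Pp; apply: eq_fsbigr => q /[!inE] -[Pq _ _].
apply: (L2t_Hsemi_restr sigma mGamma mv).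
- by apply: measurableI; exact: m1.
- by move=> t [pt _]; exact: s1 Pp _ pt.
- by apply: measurableU; exact: m2.
- by move=> x [px|qx]; [exact: s2 Pp _ px|exact: s2 Pq _ qx].
Qed.

Lemma eta_t2_restr v p : measurable_fun lat v -> P p ->
  eta_t2 sigma P v p = eta_t2 sigma P (restr_lateral T Gamma v) p.
Proof.
move=> mv Pp; apply: eq_fsbigr => q /[!inE] -[Pq _ _].
apply: (Ht_semi_restr sigma mGamma mv).
- by apply: measurableU; exact: m1.
- by move=> t [pt|qt]; [exact: s1 Pp _ pt|exact: s1 Pq _ qt].
- by apply: measurableI; exact: m2.
- by move=> x [px _]; exact: s2 Pp _ px.
Qed.

Section Measurable.
Variable u : ST R n -> R.
Hypothesis um : measurable_fun setT u.

(** The inner integrals run over all of [Gamma], respectively [I], so that the densities do not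
    depend on the pair of prisms. *)
Let gx z := (\int[sigma]_(y in Gamma) diffx u z y)%E.
Let gt z := (\int[mu]_(s in I) difft u z s)%E.

Let mgx : measurable_fun setT gx. Proof. exact: measurable_int_diffx. Qed.

Let mgt : measurable_fun setT gt.
Proof. by apply: measurable_int_difft => //; exact: measurable_itv. Qed.

Let gx0 z : (0 <= gx z)%E.
Proof. by apply: integral_ge0 => y _; exact: diffx_ge0. Qed.

Let gt0 z : (0 <= gt z)%E.
Proof. by apply: integral_ge0 => y _; exact: difft_ge0. Qed.

Let Ax p q : set (ST R n) := (p.1 `&` q.1) `*` p.2.
Let At p q : set (ST R n) := p.1 `*` (p.2 `&` q.2).

Let mAx p q : P p -> P q -> measurable (Ax p q).
Proof.
by move=> Pp Pq; apply: measurableX; [apply: measurableI; exact: m1|exact: m2].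
Qed.

Let mAt p q : P p -> P q -> measurable (At p q).
Proof.
by move=> Pp Pq; apply: measurableX; [exact: m1|apply: measurableI; exact: m2].
Qed.

(** Over the common times, the union of the two surface parts consists of a piece of each prism,
    [Ax p q] and [Ax q p]. Enlarging the inner integral to [Gamma] only increases it. *)
Lemma eta_x_term p q : P p -> P q ->
  (L2t_norm2 (p.1 `&` q.1) (H_semi2 sigma (1 / 2) (p.2 `|` q.2)) u <=
   \int[mu \x sigma]_(z in Ax p q) gx z +
   \int[mu \x sigma]_(z in Ax q p) gx z)%E.
Proof.
move=> Pp Pq; have mJ : measurable (p.1 `&` q.1 : set (measurableTypeR R)).
  by apply: measurableI; exact: m1.
have mK : measurable (p.2 `|` q.2) by apply: measurableU; exact: m2.
have KG : p.2 `|` q.2 `<=` Gamma.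
  by move=> x [px|qx]; [exact: s2 Pp _ px|exact: s2 Pq _ qx].
apply: (@le_trans _ _
    (\int[mu \x sigma]_(z in (p.1 `&` q.1) `*` (p.2 `|` q.2)) gx z)%E).
  rewrite (integral_setX mu sigma mJ mK mgx gx0).
  have mG := measurable_fun_integral sigma mK mgx gx0.
  apply: (ge0_le_integral mu mJ).
  - move=> t _; apply: integral_ge0 => x _; apply: integral_ge0 => y _.
    exact: (diffx_ge0 u (t, x) y).
  - by apply: measurable_funTS; exact: measurable_H_semi2.
  - exact: (measurable_funTS mG).
  move=> t _; apply: (ge0_le_integral sigma mK).
  - by move=> x _; apply: integral_ge0 => y _; exact: (diffx_ge0 u (t, x) y).
  - apply: measurable_funTS.
    exact: (measurable_fun_pair2 t (measurable_int_diffx sigma um mK)).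
  - by apply: measurable_funTS; exact: (measurable_fun_pair2 t mgx).
  move=> x _; apply: (ge0_subset_integral sigma mK mGamma (f := diffx u (t, x))) => //.
    apply: measurable_funTS.
    exact: (measurable_fun_pair2 (t, x) (measurable_diffx um)).
  by move=> y _; exact: diffx_ge0.
have -> : (p.1 `&` q.1) `*` (p.2 `|` q.2) = Ax p q `|` Ax q p.
  apply/seteqP; split => [[t x] [[/= pt qt] [px|qx]]|[t x] [[[/= pt qt] px]|[[/= qt pt] qx]]].
  - by left.
  - by right.
  - by split; [|left].
  - by split; [|right].
by apply: le_integral_setU => //; exact: mAx.
Qed.

Lemma eta_t_term p q : P p -> P q ->
  (Ht_semi2 (1 / 4) (p.1 `|` q.1) (L2_norm2 sigma (p.2 `&` q.2)) u <=
   \int[mu \x sigma]_(z in At p q) gt z +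
   \int[mu \x sigma]_(z in At q p) gt z)%E.
Proof.
move=> Pp Pq; have mJ : measurable (p.1 `|` q.1 : set (measurableTypeR R)).
  by apply: measurableU; exact: m1.
have mK : measurable (p.2 `&` q.2) by apply: measurableI; exact: m2.
have JT : p.1 `|` q.1 `<=` `[0, T]%classic.
  by move=> t [pt|qt]; [exact: s1 Pp _ pt|exact: s1 Pq _ qt].
rewrite Ht_semi2E//.
have h0 z : (0 <= \int[mu]_(s in p.1 `|` q.1) difft u z s)%E.
  by apply: integral_ge0 => s _; exact: difft_ge0.
have mh := measurable_int_difft um mJ.
apply: (@le_trans _ _
    (\int[mu \x sigma]_(z in (p.1 `|` q.1) `*` (p.2 `&` q.2)) gt z)%E).
  rewrite (integral_setX mu sigma mJ mK mgt gt0).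
  have mG := measurable_fun_integral sigma mK mgt gt0.
  have mH := measurable_fun_integral sigma mK mh h0.
  apply: (ge0_le_integral mu mJ).
  - by move=> t _; apply: integral_ge0 => x _; exact: h0.
  - exact: (measurable_funTS mH).
  - exact: (measurable_funTS mG).
  move=> t _; apply: (ge0_le_integral sigma mK).
  - by move=> x _; exact: h0.
  - by apply: measurable_funTS; exact: (measurable_fun_pair2 t mh).
  - by apply: measurable_funTS; exact: (measurable_fun_pair2 t mgt).
  move=> x _; have md : measurable_fun (setT : set (measurableTypeR R))
      (fun s => difft u (t, x) s).
    exact: (measurable_fun_pair2 (t, x) (measurable_difft um)).
  (* The prisms may contain the end times, but [gt] integrates over the open interval; the endpoints
     carry no mass. *)
  rewrite /gt -(@integral_itv_bndoo _ 0 T _ true false); last exact: measurable_funTS.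
  have mT : measurable (`[0, T]%classic : set (measurableTypeR R)).
    exact: measurable_itv.
  apply: (ge0_subset_integral mu mJ mT (f := difft u (t, x))) => //.
  - exact: measurable_funTS.
  - by move=> s _; exact: difft_ge0.
have -> : (p.1 `|` q.1) `*` (p.2 `&` q.2) = At p q `|` At q p.
  apply/seteqP; split => [[t x] [[pt|qt] [/= px qx]]|[t x] [[/= pt [px qx]]|[/= qt [qx px]]]].
  - by left.
  - by right.
  - by split; [left|].
  - by split; [right|].
by apply: le_integral_setU => //; exact: mAt.
Qed.

(** The 2 comes from [fsume_le_sym]; [Cnei] and 4 bound the number of neighbours sharing a generic
    time or surface point. *)
Lemma eta2_le_semi Cnei Cshape Clqu :
  nei_const T Gamma P Cnei -> shape_const sigma T Gamma P Cshape ->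
  lqu_const sigma T Gamma P Clqu ->
  (eta2 sigma P u <= (2 * Cnei)%:E * lat_semix sigma T Gamma u +
    (2 * 4)%:E * lat_semit sigma T Gamma u)%E.
Proof.
move=> hnei hshape hlqu; have Cnei0 : 0 <= Cnei by rewrite (le_trans _ hnei.1).
have fin_x p : finite_set (nei_x P p) by exact: sub_finite_set (@nei_xP _ _ _ p) fP.
have fin_t p : finite_set (nei_t sigma P p).
  exact: sub_finite_set (@nei_tP _ _ _ _ p) fP.
rewrite /eta2 /eta_loc2 fsbig_split//=; apply: leeD.
- have ax0 p q : (0 <= \int[mu \x sigma]_(z in Ax p q) gx z)%E.
    by apply: integral_ge0 => z _; exact: gx0.
  apply: (le_trans (fsume_le_sym fP (@nei_xP _ _ _) (@nei_x_sym _ _ _) ax0 eta_x_term)).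
  rewrite mulr_natl mulr2n EFinD ge0_muleDl ?lee_fin//.
  suff h : (\sum_(p \in P) \sum_(q \in nei_x P p)
      \int[mu \x sigma]_(z in Ax p q) gx z <=
      Cnei%:E * lat_semix sigma T Gamma u)%E by exact: leeD.
  have AD p q : P p -> nei_x P p q -> Ax p q `<=` p.1 `*` p.2.
    by move=> _ _ [t x] [[pt _] px].
  apply: (weighted_overlap_bound fP (@nei_xP _ _ _) Cnei0
    (measurable_lateral T mGamma) mgx gx0 mAx AD).
  + exact: (ae_mesh_lateral hP).
  + exact: (ae_mesh_unique hP).
  + move: (ae_prod_fst sigma (ae_card_nei_x n1 hP hnei hshape)).
    apply: filterS => z h p Pp [pt px]; apply: le_trans (h p Pp pt).
    rewrite ler_nat; apply: fsubset_leq_card; rewrite -fset_set_sub.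
    * by move=> q [Nq [[_ qt] _]].
    * by apply: sub_finite_set fP => q [/nei_xP].
    * by apply: sub_finite_set fP => q [/nei_xP].
- have at0 p q : (0 <= \int[mu \x sigma]_(z in At p q) gt z)%E.
    by apply: integral_ge0 => z _; exact: gt0.
  apply: (le_trans (fsume_le_sym fP (@nei_tP _ _ _ _) (@nei_t_sym _ _ _ _) at0 eta_t_term)).
  rewrite mulr_natl mulr2n EFinD ge0_muleDl ?lee_fin//.
  suff h : (\sum_(p \in P) \sum_(q \in nei_t sigma P p)
      \int[mu \x sigma]_(z in At p q) gt z <=
      4%:E * lat_semit sigma T Gamma u)%E by exact: leeD.
  have AD p q : P p -> nei_t sigma P p q -> At p q `<=` p.1 `*` p.2.
    by move=> _ _ [t x] [pt [px _]].
  apply: (weighted_overlap_bound fP (@nei_tP _ _ _ _) (ler0n R 4)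
    (measurable_lateral T mGamma) mgt gt0 mAt AD).
  + exact: (ae_mesh_lateral hP).
  + exact: (ae_mesh_unique hP).
  + move: (ae_prod_fst sigma (ae_time_overlap hP)).
    move: (ae_prod_snd mu (ae_card_nei_t hP hlqu)).
    apply: filterS2 => z h h' p Pp [pt px].
    (* A generic time in [p.1], viewed as an overlap of [p] with itself, shows that [p.1] is
       nondegenerate. *)
    have p0 : (0 < mu p.1)%E by have := h' p p Pp Pp; rewrite setIid; exact.
    apply: le_trans (h p Pp px p0).
    rewrite ler_nat; apply: fsubset_leq_card; rewrite -fset_set_sub.
    * by move=> q [Nq [_ [_ qx]]].
    * by apply: sub_finite_set fP => q [/nei_tP].
    * by apply: sub_finite_set fP => q [/nei_tP].
Qed.

End Measurable.
Lemma eta_x2_ge0 v p : (0 <= eta_x2 sigma P v p)%E.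
Proof.
rewrite /eta_x2 fsbig_finite; last exact: sub_finite_set (@nei_xP _ _ _ p) fP.
apply: sume_ge0 => q _; apply: integral_ge0 => t _.
apply: integral_ge0 => x _; apply: integral_ge0 => y _.
exact: (diffx_ge0 v (t, x) y).
Qed.

Lemma eta_t2_ge0 v p : (0 <= eta_t2 sigma P v p)%E.
Proof.
rewrite /eta_t2 fsbig_finite; last exact: sub_finite_set (@nei_tP _ _ _ _ p) fP.
apply: sume_ge0 => q _; apply: integral_ge0 => t _.
apply: integral_ge0 => s _; apply: mule_ge0.
  by apply: integral_ge0 => x _; rewrite lee_fin sqr_ge0.
by rewrite lee_fin invr_ge0 powR_ge0.
Qed.

Lemma eta2_restr v : measurable_fun lat v ->
  eta2 sigma P v = eta2 sigma P (restr_lateral T Gamma v).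
Proof.
move=> mv; apply: eq_fsbigr => p /[!inE] Pp.
exact: congr2 (eta_x2_restr mv Pp) (eta_t2_restr mv Pp).
Qed.

(** The counts [2 * Cnei] and [8] lie below the prescribed maximum, and the more so below its
    square, as that maximum is at least 32. The L_2 parts of the norm are simply dropped. *)
Lemma eta2_le_Hplus_norm Cnei Cshape Clqu v :
  nei_const T Gamma P Cnei -> shape_const sigma T Gamma P Cshape ->
  lqu_const sigma T Gamma P Clqu -> Hplus sigma T Gamma v ->
  (eta2 sigma P v <= ((Num.max (2 * (Cnei + 1) ^+ 2) 32) ^+ 2 *
    Hplus_norm sigma T Gamma v ^+ 2)%:E)%E.
Proof.
move=> hnei hshape hlqu vp; have Cnei1 := hnei.1.
have mv := measurable_restr_lateral mGamma vp.1.
rewrite (eta2_restr vp.1) EFinM (Hplus_normE vp) Haniso_norm2_restr.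
apply: (le_trans (eta2_le_semi mv hnei hshape hlqu)).
set C := Num.max _ _; rewrite (Haniso_norm2E sigma T mGamma mv).
move: (restr_lateral _ _ _) => u {mv}.
move: (lat_L2_ge0 sigma T Gamma u) (lat_semix_ge0 sigma T Gamma u)
  (lat_semit_ge0 sigma T Gamma u).
move: (lat_L2 _ _ _ _) (lat_semix _ _ _ _) (lat_semit _ _ _ _) => l x t l0 x0 t0.
have C1 : 32 <= C by rewrite le_max lexx orbT.
have C2 : 2 * (Cnei + 1) ^+ 2 <= C by rewrite le_max lexx.
have Cx : 2 * Cnei <= C ^+ 2 by nra.
have Ct : 2 * 4 <= C ^+ 2 by nra.
have C0 : (0 <= (C ^+ 2)%:E)%E by rewrite lee_fin sqr_ge0.
rewrite ge0_muleDr ?adde_ge0//; apply: leeD.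
  apply: (@le_trans _ _ ((C ^+ 2)%:E * x)%E).
    by rewrite lee_wpmul2r// lee_fin.
  by rewrite lee_wpmul2l// leeDr.
apply: (@le_trans _ _ ((C ^+ 2)%:E * t)%E).
  by rewrite lee_wpmul2r// lee_fin.
by rewrite lee_wpmul2l// leeDr.
Qed.

End EtaBound.
(** * Poincare inequality on a prism *)

Section Variance.
Context d (X : measurableType d) (R : realType).
Variables (mu : {measure set X -> \bar R}) (D : set X) (c : R)
  (f : X -> R).
Hypotheses (mD : measurable D) (Dc : mu D = c%:E)
  (mf : measurable_fun setT f) (f2 : (\int[mu]_(z in D) (f z ^+ 2)%:E < +oo)%E).

Lemma integrable_cst_fin (a : R) : mu.-integrable D (cst a%:E).
Proof.
apply/integrableP; split; first exact: measurable_cst.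
by rewrite (integral_cst mu mD `|a%:E|%E) Dc -EFinM ltry.
Qed.

Lemma integrable_sqr : mu.-integrable D (EFin \o (fun z => f z ^+ 2)).
Proof.
apply/integrableP; split.
  by apply/measurable_EFinP; apply: measurable_funTS; exact: measurable_funX.
apply: le_lt_trans f2; apply: ge0_le_integral => //.
- by apply/measurableT_comp => //; apply/measurable_EFinP; apply: measurable_funTS;
    exact: measurable_funX.
- by apply/measurable_EFinP; apply: measurable_funTS; exact: measurable_funX.
- by move=> z _ /=; rewrite ger0_norm ?sqr_ge0.
Qed.

Lemma integrable_of_sqr : mu.-integrable D (EFin \o f).
Proof.
(* On a set of finite measure, [1 + f ^+ 2] is an integrable majorant of the absolute value of
   [f]. *)
apply: (@le_integrable _ _ _ mu D mD _ (EFin \o (fun z => 1 + f z ^+ 2))).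
- by apply/measurable_EFinP; exact: measurable_funTS.
- move=> z _ /=; rewrite lee_fin [leRHS]ger0_norm ?addr_ge0 ?sqr_ge0//.
  rewrite -(real_normK (num_real (f z))).
  have := normr_ge0 (f z); move: (`|f z|) => y y0; nra.
- by apply: (integrableD mD (integrable_cst_fin 1) integrable_sqr).
Qed.

(** Expand the square: the mixed term integrates to zero, and each of the two squares contributes
    [c] times the same integral. *)
Lemma integral_sqr_diff : (\int[mu]_(z in D) (f z)%:E = 0)%E ->
  (\int[mu]_(w in D) \int[mu]_(z in D) ((f w - f z) ^+ 2)%:E =
   (2 * c)%:E * \int[mu]_(z in D) (f z ^+ 2)%:E)%E.
Proof.
move=> f0; set N := (\int[mu]_(z in D) (f z ^+ 2)%:E)%E.
have c0 : (0 <= c%:E)%E by rewrite -Dc measure_ge0.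
have N0 : (0 <= N)%E by apply: integral_ge0 => z _; rewrite lee_fin sqr_ge0.
have inner w : (\int[mu]_(z in D) ((f w - f z) ^+ 2)%:E =
    (f w ^+ 2 * c)%:E + N)%E.
  have -> : (\int[mu]_(z in D) ((f w - f z) ^+ 2)%:E =
      \int[mu]_(z in D) ((f w ^+ 2)%:E + ((- 2 * f w)%:E * (f z)%:E + (f z ^+ 2)%:E)))%E.
    by apply: eq_integral => z _; rewrite -!EFinM -!EFinD; congr EFin; ring.
  rewrite integralD//; last 2 first.
  - exact: integrable_cst_fin.
  - apply: integrableD => //; last exact: integrable_sqr.
    by apply: integrableZl => //; exact: integrable_of_sqr.
  rewrite (integral_cst mu mD) Dc -EFinM integralD//; last 2 first.
  - by apply: integrableZl => //; exact: integrable_of_sqr.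
  - exact: integrable_sqr.
  by rewrite integralZl ?f0 ?mule0 ?add0e//; exact: integrable_of_sqr.
under eq_integral do rewrite inner.
rewrite ge0_integralD//; last 2 first.
- by move=> z _; rewrite EFinM mule_ge0// lee_fin sqr_ge0.
- apply/measurable_EFinP; apply: measurable_funTS; apply: measurable_funM.
    exact: measurable_funX.
  exact: measurable_cst.
under eq_integral do rewrite EFinM.
rewrite ge0_integralZr//; last 2 first.
- by apply/measurable_EFinP; apply: measurable_funTS; exact: measurable_funX.
- by move=> z _; rewrite lee_fin sqr_ge0.
rewrite -/N; have -> : (\int[mu]_(z in D) N = c%:E * N)%E.
  by rewrite (integral_cst mu mD) Dc muleC.
by rewrite [X in (X + _)%E]muleC mulr_natl mulr2n EFinD ge0_muleDl.
Qed.

End Variance.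
Section Poincare.
Context (R : realType) (n : nat)
  (sigma : {finite_measure set (Rn R n) -> \bar R}).
Local Notation mu := (@lebesgue_measure R).
Variables (J : set R) (K : set (Rn R n)) (l k d : R) (u : ST R n -> R).
Hypotheses (n1 : (0 < n)%N) (mJ : measurable (J : set (measurableTypeR R)))
  (mK : measurable K)
  (Jl : mu J = l%:E) (Kk : sigma K = k%:E) (l0 : 0 < l) (k0 : 0 < k)
  (Jdiam : forall t s, J t -> J s -> `|t - s| <= l)
  (Kdiam : forall x y : Rn R n, K x -> K y -> eudist (x : 'rV[R]_n) y <= d)
  (um : measurable_fun setT u)
  (u2 : (\int[mu \x sigma]_(z in J `*` K) (u z ^+ 2)%:E < +oo)%E)
  (u0 : (\int[mu \x sigma]_(z in J `*` K) (u z)%:E = 0)%E).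

Let d0 : 0 <= d.
Proof.
have : K !=set0.
  by apply/set0P; apply: contraTneq k0 => K0; rewrite -lte_fin -Kk K0 measure0 ltxx.
by move=> [x Kx]; exact: le_trans (eudist_ge0 _ _) (Kdiam Kx Kx).
Qed.

(** At order 1/2 the kernel has exponent [n] and is thus at least [d ^- n] off the diagonal; on the
    diagonal both sides vanish. *)
Lemma sqr_le_diffx t x y : K x -> K y ->
  (((u (t, x) - u (t, y)) ^+ 2)%:E <= (d ^+ n)%:E * diffx u (t, x) y)%E.
Proof.
move=> Kx Ky; rewrite /diffx -EFinM lee_fin/=.
have -> : n.-1%:R + 2 * (1 / 2) = n%:R :> R.
  by rewrite div1r mulfV ?pnatr_eq0// natr1 prednK.
rewrite powR_mulrn ?eudist_ge0//.
have [->|xy] := eqVneq (x : 'rV[R]_n) y.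
  by rewrite subrr expr0n/= mul0r mulr0.
have e0 : 0 < eudist (x : 'rV[R]_n) y by exact: eudist_gt0.
rewrite mulrCA ler_peMr ?sqr_ge0// ler_pdivlMr ?exprn_gt0// mul1r.
by rewrite lerXn2r ?nnegrE ?Kdiam// ltW.
Qed.

(** At order 1/4 the kernel has exponent 3/2, whence the factor [l * Num.sqrt l]. *)
Lemma sqr_le_difft t s y : J t -> J s ->
  (((u (s, y) - u (t, y)) ^+ 2)%:E <=
    (l * Num.sqrt l)%:E * difft u (s, y) t)%E.
Proof.
move=> Jt Js; rewrite /difft -EFinM lee_fin/=.
have -> : 1 + 2 * (1 / 4) = 1 + 2^-1 :> R by field.
have [->|st] := eqVneq s t.
  by rewrite subrr expr0n/= mul0r mulr0.
have e0 : 0 < `|s - t| by rewrite normr_gt0 subr_eq0.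
rewrite mulrCA ler_peMr ?sqr_ge0// ler_pdivlMr ?powR_gt0// mul1r.
rewrite powRD; last by rewrite gt_eqF ?implybT// ?normr_gt0 ?subr_eq0.
rewrite powRr1 ?(ltW e0)// powR12_sqrt ?(ltW e0)//.
by rewrite ler_pM ?sqrtr_ge0 ?(ltW e0)// ?ler_wsqrtr ?Jdiam.
Qed.

Local Notation D := (J `*` K).
Local Notation semix := (L2t_norm2 J (H_semi2 sigma (1 / 2) K) u).
Local Notation semit := (Ht_semi2 (1 / 4) J (L2_norm2 sigma K) u).

Let mD : measurable (D : set (ST R n)). Proof. exact: measurableX. Qed.

(** The integrand ignores the time of [w]; integrating over it yields the factor [l]. *)
Lemma integral_diffx_pairs :
  (\int[mu \x sigma]_(w in D) \int[mu \x sigma]_(z in D) diffx u z w.2 =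
   l%:E * semix)%E.
Proof.
pose F (q : Rn R n * ST R n) := diffx u q.2 q.1.
have mF : measurable_fun setT F.
  apply: (measurableT_comp (measurable_diffx um)
    (g := fun q : Rn R n * ST R n => (q.2, q.1))).
  exact: measurable_fun_pair.
have F0 q : (0 <= F q)%E by exact: diffx_ge0.
pose c y := (\int[mu \x sigma]_(z in D) diffx u z y)%E.
have mc : measurable_fun setT c.
  exact: (measurable_fun_integral_setX mu sigma mJ mK mF F0).
have c0 y : (0 <= c y)%E by apply: integral_ge0 => z _; exact: diffx_ge0.
have cE : (\int[sigma]_(y in K) c y = semix)%E.
  pose G (q : Rn R n * measurableTypeR R) :=
    (\int[sigma]_(x in K) diffx u (q.2, x) q.1)%E.
  have G0 q : (0 <= G q)%E by apply: integral_ge0 => x _; exact: diffx_ge0.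
  have mG : measurable_fun setT G.
    pose H (q : Rn R n * measurableTypeR R * Rn R n) := diffx u (q.1.2, q.2) q.1.1.
    apply: (measurable_fun_integral sigma mK (f := H)) => [|q]; last exact: diffx_ge0.
    apply: (measurableT_comp (measurable_diffx um)
      (g := fun q : Rn R n * measurableTypeR R * Rn R n => ((q.1.2, q.2), q.1.1))).
    apply: measurable_fun_pair; last by apply: measurableT_comp => //; exact: measurable_fst.
    apply: measurable_fun_pair => //.
    by apply: measurableT_comp => //; exact: measurable_fst.
  transitivity (\int[sigma]_(y in K) \int[mu]_(t in J) G (y, t))%E.
    apply: eq_integral => y _.
    apply: (integral_setX mu sigma mJ mK (f := fun z => diffx u z y)) => [|z].
      exact: (measurable_fun_pair1 y (measurable_diffx um)).
    exact: diffx_ge0.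
  rewrite (integral_swap sigma mu mK mJ mG G0).
  apply: eq_integral => t _.
  apply: (integral_swap sigma sigma mK mK (f := fun q => diffx u (t, q.2) q.1)) => [|q].
    apply: (measurableT_comp (measurable_diffx um)
      (g := fun q : Rn R n * Rn R n => ((t, q.2), q.1))).
    by apply: measurable_fun_pair => //; exact: measurable_fun_pair.
  exact: diffx_ge0.
rewrite (integral_setX mu sigma mJ mK (f := fun w => c w.2)); last 2 first.
- by apply: measurableT_comp => //.
- by move=> w; exact: c0.
transitivity (\int[mu]_(t in J) cst semix t)%E.
  by apply: eq_integral => t _; exact: cE.
by rewrite (integral_cst mu mJ) muleC; congr (_ * _)%E; exact: Jl.
Qed.

(** Here the space coordinate of [z] is free and contributes [k]. *)
Lemma integral_difft_pairs :
  (\int[mu \x sigma]_(w in D) \int[mu \x sigma]_(z in D) difft u w z.1 =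
   k%:E * semit)%E.
Proof.
have inner w : (\int[mu \x sigma]_(z in D) difft u w z.1 =
    k%:E * \int[mu]_(t in J) difft u w t)%E.
  have md : measurable_fun (setT : set (measurableTypeR R)) (difft u w).
    exact: (measurable_fun_pair2 w (measurable_difft um)).
  rewrite (integral_setX mu sigma mJ mK (f := fun z => difft u w z.1)); last 2 first.
  - by apply: measurableT_comp => //.
  - by move=> z; exact: difft_ge0.
  transitivity (\int[mu]_(t in J) (difft u w t * k%:E))%E.
    apply: eq_integral => t _.
    by rewrite -Kk; exact: (integral_cst sigma mK (difft u w t)).
  rewrite ge0_integralZr//; first by rewrite muleC.
  - exact: measurable_funTS.
  - by move=> t _; exact: difft_ge0.
  - by rewrite lee_fin ltW.
under eq_integral do rewrite inner.
have mh := measurable_int_difft um mJ.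
have h0 w : (0 <= \int[mu]_(t in J) difft u w t)%E.
  by apply: integral_ge0 => t _; exact: difft_ge0.
rewrite ge0_integralZl//; last 2 first.
- exact: measurable_funTS.
- by rewrite lee_fin ltW.
by rewrite (integral_setX mu sigma mJ mK mh h0) Ht_semi2E.
Qed.

Lemma poincare_prism : (\int[mu \x sigma]_(z in D) (u z ^+ 2)%:E <=
  (d ^+ n / k)%:E * semix + (Num.sqrt l)%:E * semit)%E.
Proof.
set N := (\int[mu \x sigma]_(z in D) _)%E.
have Dlk : (mu \x sigma)%E D = (l * k)%:E.
  by rewrite EFinM -Jl -Kk; exact: product_measure1E.
have N0 : (0 <= N)%E by apply: integral_ge0 => z _; rewrite lee_fin sqr_ge0.
have := integral_sqr_diff mD Dlk um u2 u0; rewrite -/N => NE.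
have mdx : measurable_fun setT (fun q : ST R n * ST R n => diffx u q.2 q.1.2).
  apply: (measurableT_comp (measurable_diffx um)
    (g := fun q : ST R n * ST R n => (q.2, q.1.2))).
  apply: measurable_fun_pair => //.
  by apply: measurableT_comp => //; exact: measurable_fst.
have mdt : measurable_fun setT (fun q : ST R n * ST R n => difft u q.1 q.2.1).
  apply: (measurableT_comp (measurable_difft um)
    (g := fun q : ST R n * ST R n => (q.1, q.2.1))).
  apply: measurable_fun_pair => //.
  by apply: measurableT_comp => //; exact: measurable_snd.
have msq : measurable_fun setT (fun q : ST R n * ST R n => ((u q.1 - u q.2) ^+ 2)%:E).
  apply/measurable_EFinP; apply: measurable_funX; apply: measurable_funB.
    by apply: (measurableT_comp um); exact: measurable_fst.
  by apply: (measurableT_comp um); exact: measurable_snd.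
pose a := 2 * d ^+ n; pose b := 2 * (l * Num.sqrt l).
have a0 : (0 <= a%:E)%E by rewrite lee_fin mulr_ge0// exprn_ge0.
have b0 : (0 <= b%:E)%E by rewrite lee_fin !mulr_ge0 ?sqrtr_ge0// ltW.
pose G (q : ST R n * ST R n) := (a%:E * diffx u q.2 q.1.2 + b%:E * difft u q.1 q.2.1)%E.
have mG1 : measurable_fun setT (fun q : ST R n * ST R n => a%:E * diffx u q.2 q.1.2)%E.
  by apply: emeasurable_funM => //; exact: measurable_cst.
have mG2 : measurable_fun setT (fun q : ST R n * ST R n => b%:E * difft u q.1 q.2.1)%E.
  by apply: emeasurable_funM => //; exact: measurable_cst.
have mG : measurable_fun setT G by exact: emeasurable_funD.
have G10 (q : ST R n * ST R n) : (0 <= a%:E * diffx u q.2 q.1.2)%E.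
  by rewrite mule_ge0 ?diffx_ge0.
have G20 (q : ST R n * ST R n) : (0 <= b%:E * difft u q.1 q.2.1)%E.
  by rewrite mule_ge0 ?difft_ge0.
have G0 q : (0 <= G q)%E by rewrite adde_ge0.
have sq0 (q : ST R n * ST R n) : (0 <= ((u q.1 - u q.2) ^+ 2)%:E)%E.
  by rewrite lee_fin sqr_ge0.
have le_G : (\int[mu \x sigma]_(w in D) \int[mu \x sigma]_(z in D)
     ((u w - u z) ^+ 2)%:E <=
   \int[mu \x sigma]_(w in D) \int[mu \x sigma]_(z in D) G (w, z))%E.
  apply: (ge0_le_integral _ mD).
  - by move=> w _; apply: integral_ge0 => z _; exact: (sq0 (w, z)).
  - exact: (measurable_funTS (measurable_fun_integral_setX mu sigma mJ mK msq sq0)).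
  - exact: (measurable_funTS (measurable_fun_integral_setX mu sigma mJ mK mG G0)).
  move=> [s y] [/= Js Ky]; apply: (ge0_le_integral _ mD).
  - by move=> z _; exact: (sq0 ((s, y), z)).
  - exact: (measurable_funTS (measurable_fun_pair2 (s, y) msq)).
  - exact: (measurable_funTS (measurable_fun_pair2 (s, y) mG)).
  move=> [t x] [/= Jt Kx]; rewrite /G/=.
  have hx := sqr_le_diffx t Kx Ky; have ht := sqr_le_difft y Jt Js.
  rewrite (EFinM 2 (d ^+ n)) (EFinM 2 (l * Num.sqrt l)) -!muleA.
  (* Detour through [(t, y)], with the time of [z] and the space coordinate of [w]: one increment is
     then free of [s] and the other free of [x], as the two pair integrals need. *)
  apply: (@le_trans _ _ (2%:E * ((u (t, x) - u (t, y)) ^+ 2)%:E +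
     2%:E * ((u (s, y) - u (t, y)) ^+ 2)%:E)%E).
    rewrite -!EFinM -EFinD lee_fin.
    move: (u (t, x)) (u (t, y)) (u (s, y)) => A B C.
    have := sqr_ge0 (A - B - (B - C)); nra.
  by apply: leeD; rewrite lee_pmul2l ?lte_fin.
have GE : (\int[mu \x sigma]_(w in D) \int[mu \x sigma]_(z in D) G (w, z) =
    a%:E * (l%:E * semix) + b%:E * (k%:E * semit))%E.
  rewrite -integral_diffx_pairs -integral_difft_pairs.
  have mx : measurable_fun setT (fun w : ST R n =>
      \int[mu \x sigma]_(z in D) diffx u z w.2)%E.
    apply: (measurable_fun_integral_setX mu sigma mJ mK mdx).
    by move=> q; exact: diffx_ge0.
  have mt : measurable_fun setT (fun w : ST R n =>
      \int[mu \x sigma]_(z in D) difft u w z.1)%E.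
    apply: (measurable_fun_integral_setX mu sigma mJ mK mdt).
    by move=> q; exact: difft_ge0.
  have x0 (w : ST R n) : (0 <= \int[mu \x sigma]_(z in D) diffx u z w.2)%E.
    by apply: integral_ge0 => z _; exact: diffx_ge0.
  have t0 (w : ST R n) : (0 <= \int[mu \x sigma]_(z in D) difft u w z.1)%E.
    by apply: integral_ge0 => z _; exact: difft_ge0.
  rewrite -(ge0_integralZl _ mD (measurable_funTS mx) (fun w _ => x0 w) a0).
  rewrite -(ge0_integralZl _ mD (measurable_funTS mt) (fun w _ => t0 w) b0).
  have mc (e : \bar R) (h : ST R n -> \bar R) : measurable_fun setT h ->
      measurable_fun D (fun w => e * h w)%E.
    move=> mh; apply: measurable_funTS.
    by apply: emeasurable_funM => //; exact: measurable_cst.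
  rewrite -(ge0_integralD _ mD (fun w _ => mule_ge0 a0 (x0 w)) (mc _ _ mx)
    (fun w _ => mule_ge0 b0 (t0 w)) (mc _ _ mt)).
  apply: eq_integral => w _.
  rewrite (ge0_integralD _ mD (fun z _ => G10 (w, z))
    (measurable_funTS (measurable_fun_pair2 w mG1)) (fun z _ => G20 (w, z))
    (measurable_funTS (measurable_fun_pair2 w mG2))).
  rewrite (ge0_integralZl _ mD (measurable_funTS (measurable_fun_pair2 w mdx))
    (fun z _ => diffx_ge0 u z w.2) a0).
  by rewrite (ge0_integralZl _ mD (measurable_funTS (measurable_fun_pair2 w mdt))
    (fun z _ => difft_ge0 u w z.1) b0).
move: le_G; rewrite NE GE.
have sx0 : (0 <= semix)%E.
  apply: integral_ge0 => t _; apply: integral_ge0 => x _.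
  by apply: integral_ge0 => y _; exact: (diffx_ge0 u (t, x) y).
have st0 : (0 <= semit)%E.
  apply: integral_ge0 => t _; apply: integral_ge0 => s _; apply: mule_ge0.
    by apply: integral_ge0 => x _; rewrite lee_fin sqr_ge0.
  by rewrite lee_fin invr_ge0 powR_ge0.
clear NE GE; move: N N0 (L2t_norm2 _ _ _) sx0 (Ht_semi2 _ _ _ _) st0.
move=> N N0 sx sx0 st st0 h.
have lk0 : 0 < 2 * (l * k) by rewrite !mulr_gt0.
(* Dividing by [2 * (l * k)] turns the coefficient [a * l] into [d ^+ n / k] and [b * k] into
   [Num.sqrt l]. *)
rewrite -(@lee_pmul2l _ (2 * (l * k))%:E)//.
apply: (le_trans h).
rewrite ge0_muleDr ?mule_ge0 ?lee_fin ?divr_ge0 ?exprn_ge0 ?sqrtr_ge0 ?(ltW k0)//.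
rewrite !muleA -!EFinM; apply: leeD;
  rewrite lee_wpmul2r// lee_fin /a /b le_eqVlt; apply/orP; left; apply/eqP.
  by field; rewrite gt_eqF.
by ring.
Qed.

End Poincare.

(** * The mean-free residual on a single prism *)

Section LocalBound.
Context (R : realType) (n : nat)
  (sigma : {finite_measure set (Rn R n) -> \bar R}) (T : R)
  (Gamma : set (Rn R n)) (P : set (prism R n)).
Hypotheses (mGamma : measurable Gamma) (n1 : (1 < n)%N)
  (hP : prismatic_mesh sigma T Gamma P).

Local Notation mu := (@lebesgue_measure R).
Local Notation I := (`]0, T[%classic : set R).
Local Notation lat := (lateral T Gamma).

Variables (r : ST R n -> R) (p : prism R n).
Hypotheses (rp : Hplus sigma T Gamma r) (Pp : P p).

Local Notation J := p.1.
Local Notation K := p.2.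
Local Notation D := (J `*` K).
Local Notation u := (restr_lateral T Gamma r).

Let pp := mesh_prism hP Pp.

Let mJ : measurable (J : set (measurableTypeR R)).
Proof. exact: prism_measurable1 pp. Qed.

Let mK : measurable K. Proof. exact: prism_measurable2 pp. Qed.

Let mD : measurable (D : set (ST R n)). Proof. exact: measurableX. Qed.

Let um : measurable_fun setT u.
Proof. exact: measurable_restr_lateral mGamma rp.1. Qed.

Let u_off z : ~ lat z -> u z = 0.
Proof.
by move=> nz; rewrite /restr_lateral patch_indic/= indicE memNset// mulr0.
Qed.

Lemma len_fin : mu J = (len J)%:E.
Proof.
have [[a [b [_ JE _]]] _] := pp; rewrite /len fineK// JE lebesgue_measure_itv/=.
by case: ifP => // _; rewrite -EFinB.
Qed.

Lemma measure_prismE : (mu \x sigma)%E D = (len J * fine (sigma K))%:E.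
Proof.
rewrite EFinM -len_fin fineK ?fin_num_measure//; exact: product_measure1E.
Qed.

Lemma integral_restr_sqr_fin :
  (\int[mu \x sigma]_(z in D) (u z ^+ 2)%:E < +oo)%E.
Proof.
have mu2 : measurable_fun setT (fun z => (u z ^+ 2)%:E).
  by apply/measurable_EFinP; exact: measurable_funX.
apply: (@le_lt_trans _ _ (lat_L2 sigma T Gamma u)).
  apply: (@le_trans _ _ (\int[mu \x sigma]_z (u z ^+ 2)%:E)%E).
    apply: ge0_subset_integral => //.
    by move=> z _; rewrite lee_fin sqr_ge0.
  rewrite /lat_L2 [leRHS]integral_mkcond le_eqVlt; apply/orP; left; apply/eqP.
  apply: eq_integral => z _; rewrite patchE; case: ifPn => // zl.
  rewrite u_off ?expr0n//; by move: zl => /negP; rewrite inE.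
apply: le_lt_trans rp.2; rewrite Haniso_norm2_restr Haniso_norm2E//.
move: (lat_L2_ge0 sigma T Gamma u) (lat_semix_ge0 sigma T Gamma u)
  (lat_semit_ge0 sigma T Gamma u).
move: (lat_L2 _ _ _ _) (lat_semix _ _ _ _) (lat_semit _ _ _ _) => l x t l0 x0 t0.
by rewrite -addeA leeDl// !adde_ge0.
Qed.

Lemma integrable_restr_prism : (mu \x sigma)%E.-integrable D (EFin \o u).
Proof. exact: integrable_of_sqr mD measure_prismE um integral_restr_sqr_fin. Qed.

Lemma pw_const_delta z :
  pw_const P (fun q => (q == p)%:R) z = \1_(D : set (ST R n)) z.
Proof.
have fP : finite_set P by case: hP.
rewrite /pw_const (fsbigD1 p)//= eqxx mul1r fsbig1 ?addr0// => q [_ /= qp].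
by rewrite (negbTE (introN eqP qp)) mul0r.
Qed.

(** [of_L2] is a nested real-valued integral; integrability of [u] on the prism lets Fubini identify
    it with the integral over the product measure. *)
Lemma of_L2_delta :
  ((of_L2 sigma T Gamma (pw_const P (fun q => (q == p)%:R)) r)%:E =
   \int[mu \x sigma]_(z in D) (u z)%:E)%E.
Proof.
pose h : ST R n -> \bar R := (EFin \o u) \_ D.
have hE z : h z = (u z * \1_(D : set (ST R n)) z)%:E.
  by rewrite /h patchE indicE; case: ifP => _; rewrite ?mulr1 ?mulr0.
have ih : (mu \x sigma)%E.-integrable setT h.
  exact: (integrable_mkcond _ mD).1 integrable_restr_prism.
pose F := fubini_F sigma h.
have iF : mu.-integrable setT F by exact: integrable_fubini_F.
have FE t : I t -> (\int[sigma]_(x in Gamma)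
    (r (t, x) * pw_const P (fun q => (q == p)%:R) (t, x)))%:E =
    (fine (F t))%:E.
  move=> It; congr (fine _)%:E; rewrite /F /fubini_F integral_mkcond.
  apply: eq_integral => x _; rewrite patchE; case: ifPn => xG.
    rewrite hE pw_const_delta restr_lateralE//; exact: set_mem.
  rewrite hE u_off ?mul0r// => -[_]; rewrite -[Gamma _]/(Gamma x).
  by move: xG => /negP; rewrite inE.
rewrite /of_L2 asboolT//.
have iR : mu.-integrable I F.
  exact: (integrableS measurableT _ _ iF).
have -> : (\int[mu \x sigma]_(z in D) (u z)%:E = \int[mu]_(t in I) F t)%E.
  transitivity (\int[mu \x sigma]_z h z)%E; first exact: integral_mkcond.
  rewrite -(integral12_prod_meas1 ih) [RHS]integral_mkcond.
  apply: eq_integral => t _; rewrite patchE; case: ifPn => // tI.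
  apply: integral0_eq => x _; rewrite hE u_off ?mul0r// => -[/= It _].
  by move: tI => /negP; rewrite inE.
suff RE : (\int[mu]_(t in I) (\int[sigma]_(x in Gamma)
    (r (t, x) * pw_const P (fun q => (q == p)%:R) (t, x)))%R%:E =
    \int[mu]_(t in I) F t)%E.
  by rewrite /Rintegral [X in fine X]RE fineK// integrable_fin_num.
transitivity (\int[mu]_(t in I) (fine (F t))%:E)%E.
  by apply: eq_integral => t /[!inE] It; rewrite FE.
(* The inner integral is finite for almost every time only, so [fine] may alter it on a null set. *)
apply: ae_eq_integral => //.
- apply/measurable_EFinP; apply: measurableT_comp; first exact: fine_measurable.
  exact: measurable_int iR.
- exact: measurable_int iR.
- have := integrable_ae measurableT iF; apply: filterS => t Ft _.
  by rewrite fineK//; exact: Ft.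
Qed.

(** A prism with degenerate time interval is a null set. Otherwise [poincare_prism] applies: a prism
    is its own neighbour, so its seminorms are terms of [eta_x2] and [eta_t2], and shape regularity
    bounds [diam K ^+ n / fine (sigma K)] by [Cshape * diam K]. *)
Lemma local_L2_bound Cshape : shape_const sigma T Gamma P Cshape ->
  of_L2 sigma T Gamma (pw_const P (fun q => (q == p)%:R)) r = 0 ->
  (L2t_norm2 J (L2_norm2 sigma K) r <=
    (Cshape * diam K)%:E * eta_x2 sigma P r p +
    (Num.sqrt (len J))%:E * eta_t2 sigma P r p)%E.
Proof.
move=> hshape r0; have := of_L2_delta; rewrite r0 => /esym u0.
have ex0 := eta_x2_ge0 hP r p; have et0 := eta_t2_ge0 hP r p.
have Cs0 : 0 <= Cshape * diam K.
  by rewrite mulr_ge0 ?diam_ge0// (le_trans _ hshape.1).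
rewrite (L2t_L2_prism_restr mGamma hP rp.1 Pp) (L2t_L2E sigma um mJ mK).
have [J0|J0] := ltP 0%E (mu J); last first.
  rewrite null_set_integral//.
  - by rewrite adde_ge0// mule_ge0 ?lee_fin ?sqrtr_ge0.
  - by apply/measurable_EFinP; apply: measurable_funTS; exact: measurable_funX.
  - have : len J = 0.
      apply: le_anti; rewrite -lee_fin -len_fin J0/= -lee_fin -len_fin.
      exact: measure_ge0.
    by move=> J00; rewrite [LHS]measure_prismE J00 mul0r.
have [K0 dK] := mesh_shape n1 hP hshape Pp J0.
have l0 : 0 < len J by rewrite (len_gt0 hP Pp).
have k0 : 0 < fine (sigma K) by rewrite fine_gt0// K0 -ge0_fin_numE ?fin_num_measure.
have Kk : sigma K = (fine (sigma K))%:E by rewrite fineK// fin_num_measure.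
have Jdiam t s : J t -> J s -> `|t - s| <= len J.
  have [[a [b [_ JE _]]] _] := pp.
  move: l0; rewrite /len JE lebesgue_measure_itv/= lte_fin; case: ifP => [ab _|]; last first.
    by rewrite ltxx.
  rewrite -EFinB/= !in_itv/= ler_norml => /andP[a_t tb] /andP[a_s sb]; lra.
have Kdiam (x y : Rn R n) : K x -> K y -> eudist (x : 'rV[R]_n) y <= diam K.
  exact: (prism_eudist_le_diam pp).
have := poincare_prism (ltnW n1) mJ mK len_fin Kk l0 k0 Jdiam Kdiam um
  integral_restr_sqr_fin u0.
move=> /le_trans; apply; apply: leeD.
  have sx : (L2t_norm2 J (H_semi2 sigma (1 / 2) K) u <= eta_x2 sigma P r p)%E.
    rewrite (eta_x2_restr mGamma hP rp.1 Pp) /eta_x2 (fsbigD1 p)/=; last 2 first.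
    - by apply: sub_finite_set (@nei_xP _ _ _ p) _; case: hP.
    - split => //; first by rewrite setIid.
      by rewrite setIid; exact: prism_neq02 pp.
    apply: (@le_trans _ _ (L2t_norm2 (J `&` J) (H_semi2 sigma (1 / 2) (K `|` K)) u)).
      by rewrite setIid setUid.
    apply: leeDl; rewrite fsbig_finite; last first.
      by apply: sub_finite_set (P) _ _ => [q [[]]|]; last by case: hP.
    apply: sume_ge0 => q _; apply: integral_ge0 => t _.
    apply: integral_ge0 => x _; apply: integral_ge0 => y _.
    exact: (diffx_ge0 u (t, x) y).
  apply: (@le_trans _ _ ((diam K ^+ n / fine (sigma K))%:E * eta_x2 sigma P r p)%E).
    by rewrite lee_wpmul2l// lee_fin divr_ge0 ?exprn_ge0 ?diam_ge0// ltW.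
  rewrite lee_wpmul2r// lee_fin ler_pdivrMr// -mulrA mulrCA.
  have -> : diam K ^+ n = diam K * diam K ^+ n.-1.
    by rewrite -exprS prednK// ltnW.
  by rewrite ler_wpM2l ?diam_ge0.
have st : (Ht_semi2 (1 / 4) J (L2_norm2 sigma K) u <= eta_t2 sigma P r p)%E.
  rewrite (eta_t2_restr mGamma hP rp.1 Pp) /eta_t2 (fsbigD1 p)/=; last 2 first.
  - by apply: sub_finite_set (@nei_tP _ _ _ _ p) _; case: hP.
  - split => //; last by rewrite setIid.
    by rewrite setIid; exact: prism_neq01 pp.
  apply: (@le_trans _ _ (Ht_semi2 (1 / 4) (J `|` J) (L2_norm2 sigma (K `&` K)) u)).
    by rewrite setIid setUid.
  apply: leeDl; rewrite fsbig_finite; last first.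
    by apply: sub_finite_set (P) _ _ => [q [[]]|]; last by case: hP.
  apply: sume_ge0 => q _; apply: integral_ge0 => t _.
  apply: integral_ge0 => s _; apply: mule_ge0.
    by apply: integral_ge0 => x _; rewrite lee_fin sqr_ge0.
  by rewrite lee_fin invr_ge0 powR_ge0.
by rewrite lee_wpmul2l// lee_fin sqrtr_ge0.
Qed.

End LocalBound.
(** * Estimator bounds *)

Section Estimates.
Context (R : realType) (n : nat)
  (sigma : {finite_measure set (Rn R n) -> \bar R}) (T : R)
  (Gamma : set (Rn R n)) (P : set (prism R n)).
Hypotheses (mGamma : measurable Gamma) (n1 : (1 < n)%N)
  (hP : prismatic_mesh sigma T Gamma P).
Implicit Types (p : prism R n) (r : ST R n -> R).

Let fP : finite_set P. Proof. by case: hP. Qed.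

(** At a generic time a point of [Gamma] lies in a prism of positive duration, whose surface part
    has positive measure by [mesh_shape]. *)
Lemma mesh_surface_gt0 Cshape : 0 < T -> Gamma !=set0 ->
  shape_const sigma T Gamma P Cshape -> (0 < sigma Gamma)%E.
Proof.
move=> T0 [x Gx] hshape.
have IT : `]0, T[%classic `<=` (`[0, T]%classic : set R).
  by move=> t; rewrite /= !in_itv/= => /andP[t0 tT]; rewrite !ltW.
have mI : measurable (`]0, T[%classic : set (measurableTypeR R)).
  exact: measurable_itv.
have I0 : (0 < @lebesgue_measure R (`]0%R, T[%classic : set R))%E.
  by rewrite lebesgue_measure_itv/= lte_fin T0 -EFinB lte_fin subr0.
have hQ : ae_time T (fun t => forall p q, P p -> P q -> (p.1 `&` q.1) t ->
    (0 < @lebesgue_measure R (p.1 `&` q.1))%E).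
  have [N [mN N0 hN]] := ae_time_overlap hP; exists N; split => // t nQ.
  by apply: hN => h; apply: nQ => _.
have [t It ht] := ae_time_exists hQ mI IT I0.
have : lateral T Gamma (t, x) by [].
have [_ _ _ ->] := hP; move=> [[p Pp [pt px]] _].
have p0 : (0 < @lebesgue_measure R p.1)%E.
  by have := ht p p Pp Pp; rewrite setIid; exact.
apply: (lt_le_trans (mesh_shape n1 hP hshape Pp p0).1).
rewrite le_measure ?inE//; last exact: prism_sub2 (mesh_prism hP Pp).
exact: prism_measurable2 (mesh_prism hP Pp).
Qed.

Lemma L2t_L2_ge0 r p : (0 <= L2t_norm2 p.1 (L2_norm2 sigma p.2) r)%E.
Proof.
apply: integral_ge0 => t _; apply: integral_ge0 => x _.
by rewrite lee_fin sqr_ge0.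
Qed.

Lemma eta_loc2_ge0 r p : (0 <= eta_loc2 sigma P r p)%E.
Proof. exact: adde_ge0 (eta_x2_ge0 hP r p) (eta_t2_ge0 hP r p). Qed.

Lemma eta2_ge0 r : (0 <= eta2 sigma P r)%E.
Proof.
by rewrite /eta2 fsbig_finite//; apply: sume_ge0 => p _; exact: eta_loc2_ge0.
Qed.

Lemma zeta_loc2E r p : zeta_loc2 sigma r p =
  (((diam p.2)^-1 + (Num.sqrt (len p.1))^-1)%:E *
    L2t_norm2 p.1 (L2_norm2 sigma p.2) r)%E.
Proof.
by rewrite EFinD ge0_muleDl ?lee_fin ?invr_ge0 ?diam_ge0 ?sqrtr_ge0.
Qed.

Lemma zeta_loc2_ge0 r p : (0 <= zeta_loc2 sigma r p)%E.
Proof.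
rewrite zeta_loc2E mule_ge0 ?L2t_L2_ge0//.
by rewrite lee_fin addr_ge0 ?invr_ge0 ?diam_ge0 ?sqrtr_ge0.
Qed.

Lemma zeta2_ge0 r : (0 <= zeta2 sigma P r)%E.
Proof.
by rewrite /zeta2 fsbig_finite//; apply: sume_ge0 => p _; exact: zeta_loc2_ge0.
Qed.

Lemma localization_norm_le C r : localization_const sigma T Gamma P C ->
  Hplus sigma T Gamma r ->
  ((Hplus_norm sigma T Gamma r)%:E <=
    C%:E * sqrte (eta2 sigma P r + zeta2 sigma P r))%E.
Proof.
move=> [C0 hC] rp; have := hC r rp.
have -> : (\sum_(p \in P) ((diam p.2)^-1 + (Num.sqrt (len p.1))^-1)%:E *
    L2t_norm2 p.1 (L2_norm2 sigma p.2) r = zeta2 sigma P r)%E.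
  by apply: eq_fsbigr => p _; rewrite zeta_loc2E.
have h0 := adde_ge0 (eta2_ge0 r) (zeta2_ge0 r).
rewrite -(lee_sqrt _ h0) -exprVn -exprMn EFin_expe sqrte_sqr.
have N0 := Hplus_norm_ge0 sigma T Gamma r.
rewrite gee0_abs ?lee_fin ?mulr_ge0 ?invr_ge0 ?(ltW C0)// => h.
apply: le_trans (lee_wpmul2l _ h); last by rewrite lee_fin ltW.
by rewrite -EFinM mulrA mulfV ?mul1r// gt_eqF.
Qed.

Lemma eta_le_norm C r : 0 <= C ->
  (eta2 sigma P r <= (C ^+ 2 * Hplus_norm sigma T Gamma r ^+ 2)%:E)%E ->
  (eta sigma P r <= (C * Hplus_norm sigma T Gamma r)%:E)%E.
Proof.
move=> C0; have N0 := Hplus_norm_ge0 sigma T Gamma r.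
rewrite -exprMn -lee_sqrt; last by rewrite lee_fin sqr_ge0.
by rewrite EFin_expe sqrte_sqr gee0_abs// lee_fin mulr_ge0.
Qed.

(** The space and time weights are compared with [C] separately, so that one statement serves both
    the constant of (b) and the smaller one available in (c). *)
Lemma zeta_loc2_le_eta C r p Cshape : 1 <= Cshape ->
  (L2t_norm2 p.1 (L2_norm2 sigma p.2) r <=
    (Cshape * diam p.2)%:E * eta_x2 sigma P r p +
    (Num.sqrt (len p.1))%:E * eta_t2 sigma P r p)%E ->
  ((diam p.2)^-1 + (Num.sqrt (len p.1))^-1) * (Cshape * diam p.2) <= C ->
  ((diam p.2)^-1 + (Num.sqrt (len p.1))^-1) * Num.sqrt (len p.1) <= C ->
  (zeta_loc2 sigma r p <= C%:E * eta_loc2 sigma P r p)%E.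
Proof.
move=> Cs hL hx ht; rewrite zeta_loc2E /eta_loc2.
have ex0 := eta_x2_ge0 hP r p; have et0 := eta_t2_ge0 hP r p.
set w := (diam p.2)^-1 + _ in hx ht *.
have w0 : (0 <= w%:E)%E.
  by rewrite lee_fin addr_ge0 ?invr_ge0 ?diam_ge0 ?sqrtr_ge0.
apply: (le_trans (lee_wpmul2l w0 hL)).
have d0 := diam_ge0 (p.2 : set 'rV[R]_n); have h0 := sqrtr_ge0 (len p.1).
rewrite ge0_muleDr ?mule_ge0 ?lee_fin ?mulr_ge0// ?(le_trans ler01)//.
rewrite !muleA -!EFinM (ge0_muleDr _ ex0 et0).
by apply: leeD; rewrite lee_wpmul2r// lee_fin.
Qed.

End Estimates.

(** In each product one summand is at most 1 and the other at most [Cg], up to [C]; zero sizes are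
    harmless since [0^-1 = 0]. The factor [(d^-1 + h^-1) * (d + h)] of (b) already equals
    [2 * (1 + Cg)] when [Cg = 1] and [d = h] is positive, leaving no room for [eta2] in the constant
    of (c). *)
Lemma graded_weights (R : realFieldType) (d h C Cg : R) :
  0 <= d -> 0 <= h -> 1 <= C -> 1 <= Cg -> Cg^-1 * d <= h -> h <= Cg * d ->
  (d^-1 + h^-1) * (C * d) <= C * (1 + Cg) /\ (d^-1 + h^-1) * h <= C * (1 + Cg).
Proof.
move=> d0 h0 C1 Cg1 dh hd; have Cg0 : 0 < Cg by exact: lt_le_trans Cg1.
have dh' : d <= Cg * h by rewrite -ler_pdivrMl.
have ratio (a b : R) : 0 <= a -> 0 <= b -> a <= Cg * b -> b^-1 * a <= Cg.
  move=> a0; rewrite le_eqVlt => /predU1P[<- _|b0 ab].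
    by rewrite invr0 mul0r ltW.
  by rewrite ler_pdivrMl// mulrC.
have unit (a : R) : 0 <= a -> a^-1 * a <= 1.
  rewrite le_eqVlt => /predU1P[<-|a0]; first by rewrite mulr0.
  by rewrite mulVf// gt_eqF.
split.
  have -> : (d^-1 + h^-1) * (C * d) = C * (d^-1 * d + h^-1 * d) by ring.
  by rewrite ler_wpM2l ?(le_trans ler01)// lerD ?unit ?ratio.
rewrite mulrDl addrC (@le_trans _ _ (1 + Cg))//.
  by rewrite lerD ?unit ?ratio.
by rewrite ler_peMl// addr_ge0// ltW.
Qed.

(** * Efficiency and reliability of the estimators *)

Theorem corollary3p5 (R : realType) (n : nat) (hn : n = 2%N \/ n = 3%N)
  (Omega : set 'rV[R]_n) (hOmega : lipschitz_domain Omega)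
  (Gamma : set (Rn R n)) (hGamma : Gamma = boundary Omega)
  (sigma : {finite_measure set (Rn R n) -> \bar R})
  (hsigma : surface_measure Gamma sigma)
  (T : R) (hT : 0 < T)
  (V : ((ST R n -> R) -> R) -> (ST R n -> R))
  (hV : single_layer sigma T Gamma V)
  (f : ST R n -> R) (hf : Hplus sigma T Gamma f)
  (phi : (ST R n -> R) -> R) (hphi : Hminus sigma T Gamma phi)
  (hVphi : ae_eq_lateral sigma T Gamma (V phi) f)
  (P : set (prism R n)) (hP : prismatic_mesh sigma T Gamma P)
  (X : set ((ST R n -> R) -> R)) (hX : fin_dim_subspace sigma T Gamma X)
  (Cnei Cdist Cshape Clqu ccoe Crel' : R)
  (hCnei : nei_const T Gamma P Cnei)
  (hCdist : dist_const T Gamma P Cdist)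
  (hCshape : shape_const sigma T Gamma P Cshape)
  (hClqu : lqu_const sigma T Gamma P Clqu)
  (hccoe : coercive_with sigma T Gamma V ccoe)
  (hCrel' : localization_const sigma T Gamma P Crel') :
  let Ccont := single_layer_norm sigma T Gamma V in
  let Ceff' := Num.max (2 * (Cnei + 1) ^+ 2) 32 in
  let Ceff := Ceff' * Ccont in
  let tCrel := Crel' / ccoe in
  let res := fun Phi => f \- V Phi in
  let err := fun Phi => Hminus_norm sigma T Gamma (phi \- Phi) in
  [/\ (* (a) *)
      [/\ 0 < Ceff, 0 < tCrel &
        forall Phi, X Phi ->
          ((Ceff^-1)%:E * eta sigma P (res Phi) <= (err Phi)%:E)%E /\
          ((err Phi)%:E <= tCrel%:E *
             sqrte (eta2 sigma P (res Phi) + zeta2 sigma P (res Phi)))%E],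
      (* (b) *)
      contains_pw_const sigma T Gamma P X ->
      forall Phi, galerkin V f X Phi ->
      forall p, P p ->
        (zeta_loc2 sigma (res Phi) p <=
          (Cshape * ((diam p.2)^-1 + (Num.sqrt (len p.1))^-1) *
             (diam p.2 + Num.sqrt (len p.1)))%:E *
          eta_loc2 sigma P (res Phi) p)%E &
      (* (c) *)
      contains_pw_const sigma T Gamma P X ->
      forall Cgrad : R, 1 <= Cgrad ->
      (forall p, P p -> Cgrad^-1 * diam p.2 <= Num.sqrt (len p.1)
                        /\ Num.sqrt (len p.1) <= Cgrad * diam p.2) ->
      let Crel := tCrel * Num.sqrt (2 * Cshape * (1 + Cgrad)) in
      0 < Crel /\
      forall Phi, galerkin V f X Phi ->
        ((err Phi)%:E <= Crel%:E * eta sigma P (res Phi))%E].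
Proof.
have n1 : (1 < n)%N by case: hn => ->.
have mGamma : measurable Gamma.
  rewrite hGamma; apply: (closed_measurable_Rn (A := boundary Omega)).
  by apply: closedI; [exact: closed_closure|apply: open_closedC; exact: open_interior].
have Gamma0 : Gamma !=set0 by rewrite hGamma; case: hOmega.
move=> Ccont Ceff' Ceff tCrel res err.
have XHm := fin_dim_subspace_Hminus hX.
have sG := mesh_surface_gt0 mGamma n1 hP hT Gamma0 hCshape.
have Ccont0 : 0 < Ccont by exact: single_layer_norm_gt0.
have Ceff'0 : 0 < Ceff' by rewrite lt_max ltr0n orbT.
have [ccoe0 _] := hccoe; have [Crel'0 _] := hCrel'.
have tCrel0 : 0 < tCrel by rewrite divr_gt0.
have Cs1 := hCshape.1.
have resp Phi : X Phi -> Hplus sigma T Gamma (res Phi).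
  by move=> /XHm; exact: (residual_Hplus mGamma hV hf hphi hVphi).
have resE Phi : X Phi -> Hplus_norm sigma T Gamma (res Phi) =
    Hplus_norm sigma T Gamma (V (phi \- Phi)).
  by move=> /XHm; exact: (residual_norm mGamma hV hf hphi hVphi).
have errm Phi : X Phi -> Hminus sigma T Gamma (phi \- Phi).
  by move=> /XHm; exact: HminusB.
have upper Phi : X Phi -> ((err Phi)%:E <= tCrel%:E *
    sqrte (eta2 sigma P (res Phi) + zeta2 sigma P (res Phi)))%E.
  move=> XPhi; rewrite /tCrel mulrC EFinM -muleA.
  have := coercive_norm_bound mGamma hV hccoe (errm _ XPhi).
  rewrite -resE// -lee_fin => /le_trans; apply; rewrite EFinM.
  apply: lee_wpmul2l; first by rewrite lee_fin invr_ge0 ltW.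
  exact: (localization_norm_le hP hCrel' (resp _ XPhi)).
(* The Galerkin property enters here alone; both (b) and (c) rest on this bound. *)
have galerkin_L2_bound : contains_pw_const sigma T Gamma P X ->
    forall Phi, galerkin V f X Phi -> forall p, P p ->
    (L2t_norm2 p.1 (L2_norm2 sigma p.2) (res Phi) <=
      (Cshape * diam p.2)%:E * eta_x2 sigma P (res Phi) p +
      (Num.sqrt (len p.1))%:E * eta_t2 sigma P (res Phi) p)%E.
  move=> hpw Phi [XPhi gal] p Pp.
  apply: (local_L2_bound mGamma n1 hP (resp _ XPhi) Pp hCshape).
  have XPsi := hpw (fun q => (q == p)%:R).
  rewrite (HminusBE (XHm _ XPsi) hf (single_layer_Hplus hV (XHm _ XPhi))).
  by have := gal _ XPsi; rewrite /pairing => ->; rewrite subrr.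
split.
- split=> //; first by rewrite mulr_gt0.
  move=> Phi XPhi; split; last exact: upper.
  have h := eta_le_norm (ltW Ceff'0)
    (eta2_le_Hplus_norm mGamma n1 hP hCnei hCshape hClqu (resp _ XPhi)).
  apply: (@le_trans _ _ (Ceff^-1 * (Ceff' * (Ccont * err Phi)))%:E).
    rewrite [leRHS]EFinM; apply: lee_wpmul2l.
      by rewrite lee_fin invr_ge0 mulr_ge0 ?ltW.
    apply: (le_trans h); rewrite lee_fin ler_pM2l// resE//.
    exact: (single_layer_norm_bound mGamma hV (errm _ XPhi)).
  by rewrite (mulrA Ceff') -/Ceff mulKf// gt_eqF// mulr_gt0.
- move=> hpw Phi gal p Pp.
  have d0 := diam_ge0 (p.2 : set 'rV[R]_n); have h0 := sqrtr_ge0 (len p.1).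
  set w := (diam p.2)^-1 + _.
  have w0 : 0 <= w by rewrite addr_ge0// invr_ge0.
  (* Each of [diam p.2] and [Num.sqrt (len p.1)] is below their sum, and [1 <= Cshape] supplies the
     factor lacking in the time part. *)
  apply: (zeta_loc2_le_eta hP Cs1 (galerkin_L2_bound hpw Phi gal p Pp)).
    by rewrite mulrCA mulrA ler_wpM2l ?lerDl// mulr_ge0// (le_trans ler01).
  rewrite -mulrA (@le_trans _ _ (w * (diam p.2 + Num.sqrt (len p.1))))//.
    by rewrite ler_wpM2l// lerDr.
  by rewrite ler_peMl// mulr_ge0// addr_ge0.
move=> hpw Cgrad Cg1 hgrad Crel.
have Cg0 : 0 < 1 + Cgrad by rewrite addr_gt0// (lt_le_trans ltr01).
have Cs0 : 0 < Cshape by exact: lt_le_trans ltr01 Cs1.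
have C1 : 1 <= Cshape * (1 + Cgrad).
  by rewrite -[leLHS]mulr1 ler_pM// lerDl (le_trans ler01).
split; first by rewrite mulr_gt0// sqrtr_gt0 !mulr_gt0.
move=> Phi gal; have XPhi := gal.1; apply: (le_trans (upper _ XPhi)).
rewrite /Crel (EFinM tCrel (Num.sqrt _)) -muleA; apply: lee_wpmul2l; first by rewrite lee_fin ltW.
have e0 := eta2_ge0 hP (res Phi).
have zeta_le : (zeta2 sigma P (res Phi) <=
    (Cshape * (1 + Cgrad))%:E * eta2 sigma P (res Phi))%E.
  have fP : finite_set P by case: hP.
  rewrite /zeta2 /eta2 ge0_mule_fsumr; last first.
    by move=> p; exact: (eta_loc2_ge0 hP).
  apply: lee_fsum => // p Pp; have [h1 h2] := hgrad p Pp.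
  have [k1 k2] := graded_weights (diam_ge0 (p.2 : set 'rV[R]_n))
    (sqrtr_ge0 (len p.1)) Cs1 Cg1 h1 h2.
  exact: (zeta_loc2_le_eta hP Cs1 (galerkin_L2_bound hpw Phi gal p Pp)).
have c0 : (0 <= (Cshape * (1 + Cgrad))%:E)%E by rewrite lee_fin mulr_ge0// ltW.
have sum_le : (eta2 sigma P (res Phi) + zeta2 sigma P (res Phi) <=
    (2 * Cshape * (1 + Cgrad))%:E * eta2 sigma P (res Phi))%E.
  (* [1 + c <= 2 * c] for [c = Cshape * (1 + Cgrad) >= 1]: this absorbs [eta2] itself and produces
     the 2 in [Crel]. *)
  rewrite -mulrA mulr_natl mulr2n EFinD ge0_muleDl//; apply: leeD => //.
  by rewrite -[leLHS]mul1e; apply: lee_wpmul2r.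
have -> : ((Num.sqrt (2 * Cshape * (1 + Cgrad)))%:E * eta sigma P (res Phi) =
    sqrte ((2 * Cshape * (1 + Cgrad))%:E * eta2 sigma P (res Phi)))%E.
  by rewrite sqrteM// lee_fin !mulr_ge0// ltW.
by rewrite lee_sqrt// mule_ge0// lee_fin !mulr_ge0// ltW.
Qed.
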